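(* Let $(\eta^j)_{j\ge1}$ be a family of $n$-forms on an $n$-plectic manifold $(M,\omega)$. Let $(E=E_{-n}\oplus\cdots\oplus E_{-1},\ \mu=l_1+\cdots+l_{n+1})$ be the symmetric Lie $n$-algebra associated to $(M,\omega)$. For each $2\le i\le n$ define the vector valued $i$-forms $\widetilde{(\eta^j)_i}$ on $E$ by $$\widetilde{(\eta^j)_i}(\beta_1,\dots,\beta_i)=\begin{cases}\iota_{\chi_{\beta_1}}\cdots\iota_{\chi_{\beta_i}}\eta^j,&\text{if }\beta_k\in E_{-1}\text{ for all }1\le k\le i,\\0,&\text{otherwise (for homogeneous arguments)},\end{cases}$$ where $\chi_{\beta_1},\dots,\chi_{\beta_i}$ are the Hamiltonian vector fields associated to the Hamiltonian forms $\beta_1,\dots,\beta_i$, respectively. Let $S:E\to E$ be the Euler map, $S(X)=-|X|X$ for homogeneous $X$. Then $\mathcal N:=S+\sum_{j\ge1}\sum_{i=2}^n\widetilde{(\eta^j)_i}$ is a Nijenhuis vector valued form with respect to the Lie $n$-algebra structure $\mu$.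
   Context: An $n$-plectic manifold is a manifold $M$ with a closed non-degenerate $(n+1)$-form $\omega$ (non-degenerate: $\iota_v\omega=0$ implies $v=0$). An $(n-1)$-form $\alpha$ is Hamiltonian if there is a vector field $\chi_\alpha$ (its Hamiltonian vector field, unique by non-degeneracy) with $d\alpha=-\iota_{\chi_\alpha}\omega$; $\Omega^{n-1}_{Ham}(M)$ is the space of Hamiltonian forms. The associated symmetric Lie $n$-algebra: $E_{-1}=\Omega^{n-1}_{Ham}(M)$, $E_i=\Omega^{n+i}(M)$ for $-n\le i\le-2$, $E=\oplus_{i=-n}^{-1}E_i$, $|\alpha|$ the degree in $E$; $\mu=\sum_k l_k$ where $l_1(\alpha)=(-1)^{|\alpha|}d\alpha$ for homogeneous $\alpha\notin E_{-1}$, $l_1(\alpha)=0$ for $\alpha\in E_{-1}$; and for $k\ge2$, $l_k(\alpha_1,\dots,\alpha_k)=0$ if some homogeneous $\alpha_i\notin E_{-1}$, while for all $\alpha_i\in E_{-1}$, $l_k(\alpha_1,\dots,\alpha_k)=(-1)^{\frac k2+1}\iota_{\chi_{\alpha_1}}\cdots\iota_{\chi_{\alpha_k}}\omega$ if $k$ is even, and $(-1)^{\frac{k-1}2}\iota_{\chi_{\alpha_1}}\cdots\iota_{\chi_{\alpha_k}}\omega$ if $k$ is odd. For a graded vector space $E$: a symmetric vector valued $k$-form is a graded symmetric $k$-linear map $K:E^k\to E$ (for $k=0$ an element of $E$), of degree $\bar K$ if $|K(X_1,\dots,X_k)|=\sum|X_i|+\bar K$; vector valued forms are formal sums of these. For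 a $k$-form $K$ and an $l$-form $L$ ($l\ge1$), $$\iota_KL(X_1,\dots,X_{k+l-1})=\sum_{\sigma\in Sh(k,l-1)}\epsilon(\sigma)L(K(X_{\sigma(1)},\dots,X_{\sigma(k)}),X_{\sigma(k+1)},\dots,X_{\sigma(k+l-1)}),$$ with $Sh$ the unshuffles and $\epsilon(\sigma)$ the Koszul sign; $\iota_KL=0$ if $L\in E$; $\iota_XK=K(X,\cdot,\dots)$ for $X\in E$. Richardson-Nijenhuis bracket: $[K,L]_{_{RN}}=\iota_KL-(-1)^{\bar K\bar L}\iota_LK$, extended to formal sums. For $\mu$ of degree $1$, a form $\mathcal N$ of degree zero is Nijenhuis with respect to $\mu$ if there is a form $\mathcal K$ of degree zero with $[\mathcal N,[\mathcal N,\mu]_{_{RN}}]_{_{RN}}=[\mathcal K,\mu]_{_{RN}}$ and $[\mathcal N,\mathcal K]_{_{RN}}=0$.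
   Formalization: The infinite sum over j ≥ 1 is undefined for an arbitrary family; it is assumed that the partial sums converge pointwise (on all arguments, vector fields and points) to a map with values in E, which is taken as the sum in the definition of N (finite families are included). *)

(* Defs.v *)
From HB Require Import structures.
From mathcomp Require Import all_boot all_order all_algebra.
From mathcomp Require Import perm.
From mathcomp Require Import all_classical all_reals all_analysis.
From mathcomp Require Import ring.
Set Implicit Arguments.
Unset Strict Implicit.
Unset Printing Implicit Defensive.
Import Order.TTheory GRing.Theory Num.Theory.
Import numFieldNormedType.Exports.
Local Open Scope classical_set_scope.
Local Open Scope ring_scope.

(* Partial derivatives are asked for existentially, so that only the values of
   [f] on [W] (an open set in all uses) matter. *)
Fixpoint Ck (R : realType) (m k : nat) (W : set 'rV[R]_m) (f : 'rV[R]_m -> R) :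
    Prop :=
  (forall x, W x -> {for x, continuous f}) /\
  if k is k'.+1 then
    forall i : 'I_m, exists2 g : 'rV[R]_m -> R, Ck k' W g &
      forall x, W x -> is_derive x (delta_mx 0 i) f (g x)
  else True.

Definition Cinfty (R : realType) (m : nat) (W : set 'rV[R]_m)
  (f : 'rV[R]_m -> R) : Prop := forall k, Ck k W f.

Record chart (R : realType) (T : topologicalType) (m : nat) := Chart {
  chart_dom : set T;
  chart_cod : set 'rV[R]_m;
  chart_map : T -> 'rV[R]_m;
  chart_inv : 'rV[R]_m -> T;
  chart_dom_open : open chart_dom;
  chart_cod_open : open chart_cod;
  chart_mapP : forall x, chart_dom x -> chart_cod (chart_map x);
  chart_invP : forall y, chart_cod y -> chart_dom (chart_inv y);
  chart_mapK : forall x, chart_dom x -> chart_inv (chart_map x) = x;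
  chart_invK : forall y, chart_cod y -> chart_map (chart_inv y) = y;
  chart_map_continuous : forall x, chart_dom x -> {for x, continuous chart_map};
  chart_inv_continuous : forall y, chart_cod y -> {for y, continuous chart_inv}
}.

Definition smoothly_compatible (R : realType) (T : topologicalType) (m : nat)
    (c c' : chart R T m) : Prop :=
  forall i : 'I_m,
    Cinfty (chart_cod c `&` chart_inv c @^-1` chart_dom c')
           (fun y => chart_map c' (chart_inv c y) 0 i).

Record manifold (R : realType) := Manifold {
  mpoint :> topologicalType;
  mdim : nat;
  atlas : set (chart R mpoint mdim);
  mhausdorff : hausdorff_space mpoint;
  msecond_countable : @second_countable mpoint;
  atlas_cover : forall x, exists2 c, atlas c & chart_dom c x;
  atlas_smooth : forall c c', atlas c -> atlas c' -> smoothly_compatible c c'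
}.

Section SmoothFunctions.
Context (R : realType).

Lemma Ck_continuous m k (W : set 'rV[R]_m) f :
  Ck k W f -> forall x, W x -> {for x, continuous f}.
Proof. by case: k => [|k] []. Qed.

Lemma CkW m k (W : set 'rV[R]_m) f : Ck k.+1 W f -> Ck k W f.
Proof.
elim: k f => [|k IH] f [cf Hf]; first by split.
split=> // i; have [g Hg dg] := Hf i; exists g => //; exact: IH.
Qed.

Lemma Ck_cst m k (W : set 'rV[R]_m) (c : R) : Ck k W (fun=> c).
Proof.
elim: k c => [|k IH] c; (split; first by move=> x _; exact: cst_continuous) => //.
by move=> i; exists (fun=> 0); [exact: IH | move=> x _; exact: is_derive_cst].
Qed.

Lemma CkD m k (W : set 'rV[R]_m) f g : Ck k W f -> Ck k W g -> Ck k W (f + g).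
Proof.
elim: k f g => [|k IH] f g [cf Hf] [cg Hg];
  (split; first by move=> x Wx; apply: continuousD; [exact: cf | exact: cg]) => //.
move=> i; have [f' Hf' df] := Hf i; have [g' Hg' dg] := Hg i.
exists (f' + g'); first exact: IH.
by move=> x Wx; apply: is_deriveD; [exact: df | exact: dg].
Qed.

Lemma CkM m k (W : set 'rV[R]_m) f g : Ck k W f -> Ck k W g -> Ck k W (f * g).
Proof.
elim: k f g => [|k IH] f g Ckf Ckg; have [cf Hf] := Ckf; have [cg Hg] := Ckg;
  (split; first by move=> x Wx; apply: continuousM; [exact: cf | exact: cg]) => //.
move=> i; have [f' Hf' df] := Hf i; have [g' Hg' dg] := Hg i.
exists (f * g' + g * f').
  by apply: CkD; apply: IH => //; exact: CkW.
move=> x Wx; have := df _ Wx; have := dg _ Wx => *; exact: is_deriveM.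
Qed.

Lemma CkN m k (W : set 'rV[R]_m) f : Ck k W f -> Ck k W (- f).
Proof.
move=> Hf; rewrite (_ : - f = (fun=> -1) * f); last first.
  by apply/funext => x; rewrite [RHS]mulN1r.
by apply: CkM => //; exact: Ck_cst.
Qed.

Context (M : manifold R).

Definition smooth : {pred (M -> R)} := [pred f : M -> R | `[<
  forall c, atlas c -> Cinfty (chart_cod c) (f \o chart_inv c) >]].

Lemma smooth_subring : subring_closed smooth.
Proof.
split.
- by apply/asboolP => c _ k; exact: Ck_cst.
- move=> f g /asboolP sf /asboolP sg; apply/asboolP => c Ac k.
  by apply: CkD; [exact: sf | apply: CkN; exact: sg].
- move=> f g /asboolP sf /asboolP sg; apply/asboolP => c Ac k.
  by apply: CkM; [exact: sf | exact: sg].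
Qed.
HB.instance Definition _ := GRing.isSubringClosed.Build (M -> R) smooth smooth_subring.
Lemma smooth_scale : GRing.scaler_closed smooth.
Proof.
move=> a f /asboolP sf; apply/asboolP => c Ac k.
by apply: (@CkM _ _ _ (fun=> a) (f \o chart_inv c)); [exact: Ck_cst | exact: sf].
Qed.
HB.instance Definition _ := GRing.isScaleClosed.Build R (M -> R) smooth smooth_scale.

Record Cinf := CInf { cinf_val :> M -> R; cinf_smooth : cinf_val \in smooth }.
HB.instance Definition _ := [isSub for cinf_val].
HB.instance Definition _ := [Choice of Cinf by <:].
HB.instance Definition _ := GRing.SubChoice_isSubComPzRing.Build _ _ Cinf (GRing.subringClosedP _).
HB.instance Definition _ := [SubZmodule_isSubLmodule of Cinf by <:].
End SmoothFunctions.

Section VectorFields.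
Context (R : realType) (M : manifold R).
Local Notation C := (Cinf M).

Lemma CinfZ (c : R) (f g : C) : c *: (f * g) = f * (c *: g).
Proof. by apply/val_inj/funext => x; exact: mulrCA. Qed.

Definition derivation : {pred (C -> C^o)} := [pred X : C -> C^o | `[<
  (forall (c : R) (f g : C), X (c *: f + g) = c *: (X f : C) + X g) /\
  (forall f g : C, X (f * g) = (f : C) * (X g : C) + g * X f) >]].

Lemma derivation_submod : GRing.submod_closed derivation.
Proof.
split=> [|h X Y /asboolP[lX dX] /asboolP[lY dY]]; apply/asboolP; split.
- by move=> c f g; rewrite -[RHS]/(c *: (0 : C) + 0) scaler0 addr0.
- by move=> f g; rewrite -[RHS]/((f : C) * 0 + g * (0 : C)) !mulr0 addr0.
- move=> c f g; rewrite -[LHS]/((h : C) * (X (c *: f + g) : C) + (Y (c *: f + g) : C)).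
  rewrite -[RHS]/(c *: ((h : C) * (X f : C) + (Y f : C)) + ((h : C) * (X g : C) + (Y g : C))).
  by rewrite lX lY scalerDr CinfZ mulrDr addrACA.
- move=> f g; rewrite -[LHS]/((h : C) * (X (f * g) : C) + (Y (f * g) : C)).
  rewrite -[RHS]/((f : C) * ((h : C) * (X g : C) + (Y g : C)) + g * ((h : C) * (X f : C) + (Y f : C))).
  by rewrite dX dY /=; ring.
Qed.
HB.instance Definition _ :=
  GRing.isSubmodClosed.Build C (C -> C^o) derivation derivation_submod.

(* Vector fields are the derivations of the algebra of smooth functions: the
   value at [x] of the field [X] is the tangent vector [fun f => X f x]. *)
Record vfield := VField { vf_val :> C -> C^o; vf_derivation : vf_val \in derivation }.
HB.instance Definition _ := [isSub for vf_val].
HB.instance Definition _ := [Choice of vfield by <:].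
HB.instance Definition _ := [SubChoice_isSubLmodule of vfield by <:].
Local Notation V := vfield.
Implicit Types (X Y Z : V) (f g h : C).

Lemma vfDE X Y f : (X + Y) f = X f + Y f. Proof. by []. Qed.
Lemma vfNE X f : (- X) f = - X f. Proof. by []. Qed.
Lemma vfZE h X f : (h *: X) f = h * X f. Proof. by []. Qed.

Lemma vfM X f g : X (f * g) = (f * (X g : C) + g * X f)%R.
Proof. by have /asboolP[] := vf_derivation X. Qed.
Lemma vfP X c f g : X (c *: f + g) = c *: (X f : C) + X g.
Proof. by have /asboolP[] := vf_derivation X. Qed.
Lemma vfD X : {morph X : f g / f + g}.
Proof. by move=> f g; rewrite -[f]scale1r vfP !scale1r. Qed.
Lemma vf0 X : X 0 = 0.
Proof. by apply: (@addrI _ (X 0)); rewrite -vfD !addr0. Qed.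
Lemma vfN X : {morph X : f / - f}.
Proof. by move=> f; apply/eqP; rewrite -addr_eq0 -vfD addNr vf0. Qed.
Lemma vfB X : {morph X : f g / f - g}.
Proof. by move=> f g; rewrite vfD vfN. Qed.
Lemma vfield_eq X Y : (forall f, X f = Y f) -> X = Y.
Proof. by move=> XY; apply/val_inj/funext. Qed.

Definition bracket_fun X Y : C -> C^o := fun f => (X (Y f) : C) - Y (X f).

Lemma bracket_derivation X Y : bracket_fun X Y \in derivation.
Proof.
apply/asboolP; split=> [c f g|f g]; rewrite /bracket_fun.
- by rewrite !vfP scalerBr opprD addrACA.
- by rewrite !vfM !vfD !vfM; ring.
Qed.

Definition bracket X Y : V := VField (bracket_derivation X Y).

Lemma bracketE X Y f : bracket X Y f = (X (Y f) : C) - Y (X f). Proof. by []. Qed.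
Lemma bracketXX X : bracket X X = 0.
Proof. by apply: vfield_eq => f; rewrite bracketE subrr. Qed.
Lemma bracketN X Y : bracket X Y = - bracket Y X.
Proof. by apply: vfield_eq => f; rewrite vfNE !bracketE opprB. Qed.
Lemma bracketZr X h Y Z :
  bracket X (h *: Y + Z) = (X h : C) *: Y + h *: bracket X Y + bracket X Z.
Proof.
apply: vfield_eq => f.
by rewrite !bracketE !(vfDE, vfZE) vfD vfM !bracketE; ring.
Qed.
Lemma bracket_jacobi X Y Z : bracket X (bracket Y Z) =
  bracket (bracket X Y) Z + bracket Y (bracket X Z).
Proof. by apply: vfield_eq => f; rewrite vfDE !bracketE !vfB; ring. Qed.

End VectorFields.

(* The Cartan calculus only needs the functions and the vector fields to form a
   Lie-Rinehart pair. Working with an abstract pair keeps the construction of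
   [Cinf] and [vfield] out of the way of unification. *)
Record lieRinehart (C : comPzRingType) := LieRinehart {
  lr_vec :> lmodType C;
  act : lr_vec -> C -> C;
  lie : lr_vec -> lr_vec -> lr_vec;
  actD : forall X, {morph act X : f g / f + g};
  actM : forall X f g, act X (f * g) = f * act X g + g * act X f;
  actP : forall h X Y f, act (h *: X + Y) f = h * act X f + act Y f;
  act_lie : forall X Y f,
    act X (act Y f) - act Y (act X f) = act (lie X Y) f;
  lieXX : forall X, lie X X = 0;
  lieN : forall X Y, lie X Y = - lie Y X;
  lieZr : forall X h Y Z,
    lie X (h *: Y + Z) = act X h *: Y + h *: lie X Y + lie X Z;
  jacobi : forall X Y Z, lie X (lie Y Z) = lie (lie X Y) Z + lie Y (lie X Z)
}.

Section Forms.
Context (C : comPzRingType) (V : lieRinehart C).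
Implicit Types (X Y Z : V) (f g h : C) (s t : seq V).

Lemma act0 X : act X 0 = 0.
Proof. by apply: (@addrI _ (act X 0)); rewrite -actD !addr0. Qed.
Lemma actN X : {morph act X : f / - f}.
Proof. by move=> f; apply/eqP; rewrite -addr_eq0 -actD addNr act0. Qed.
Lemma actB X : {morph act X : f g / f - g}.
Proof. by move=> f g; rewrite actD actN. Qed.
Lemma lieZl h X Y Z :
  lie (h *: X + Y) Z = h *: lie X Z - act Z h *: X + lie Y Z.
Proof. by rewrite lieN lieZr !opprD (lieN X Z) (lieN Y Z) scalerN [- _ + _ in LHS]addrC. Qed.

(* A form is a function of the finite list of its arguments: its restriction to
   the lists of size [p] is its component of degree [p]. *)
Definition multilinear (a : seq V -> C) : Prop := forall s t f X Y,
  a (s ++ (f *: X + Y) :: t) = f * a (s ++ X :: t) + a (s ++ Y :: t).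

Definition alternating (a : seq V -> C) : Prop := forall s t u X,
  a (s ++ X :: t ++ X :: u) = 0.

Local Notation raw := (seq V -> C).
Implicit Types (a b : raw).

Definition omit (i : nat) s := take i s ++ drop i.+1 s.

(* The Koszul formula for the exterior derivative. *)
Definition ext_diff a : raw := fun s =>
  \sum_(0 <= i < size s) (-1) ^+ i * act (nth 0 s i) (a (omit i s)) +
  \sum_(0 <= j < size s) \sum_(0 <= i < j)
    (-1) ^+ (i + j) * a ((lie (nth 0 s i) (nth 0 s j)) :: omit i (omit j s)).

Definition iota X a : raw := fun s => a (X :: s).

Definition lieder X a : raw := fun s =>
  act X (a s) -
  \sum_(0 <= j < size s) a (take j s ++ (lie X (nth 0 s j)) :: drop j.+1 s).

(* [preform] only asks for alternation in adjacent arguments, which is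
   equivalent for multilinear maps (lemma [preform_alt]). *)
Definition altadj a := forall s t X, a (s ++ X :: X :: t) = 0.

Definition preform a := multilinear a /\ altadj a.

Lemma mlin0 a s t : multilinear a -> a (s ++ 0 :: t) = 0.
Proof.
move=> ma; have := ma s t (-1) 0 0; rewrite scaler0 addr0 => ->.
by rewrite mulN1r addNr.
Qed.
Lemma mlinD a s t X Y : multilinear a ->
  a (s ++ (X + Y) :: t) = a (s ++ X :: t) + a (s ++ Y :: t).
Proof. by move=> ma; rewrite -{1}[X]scale1r ma mul1r. Qed.
Lemma mlinZ a s t f X : multilinear a ->
  a (s ++ (f *: X) :: t) = f * a (s ++ X :: t).
Proof. by move=> ma; rewrite -[f *: X]addr0 ma mlin0 // addr0. Qed.
Lemma mlinN a s t X : multilinear a ->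
  a (s ++ (- X) :: t) = - a (s ++ X :: t).
Proof. by move=> ma; rewrite -scaleN1r mlinZ // mulN1r. Qed.

Lemma swap_adj a s t X Y : preform a ->
  a (s ++ X :: Y :: t) = - a (s ++ Y :: X :: t).
Proof.
move=> [ma aa]; apply/eqP; rewrite -addr_eq0.
have := aa s t (X + Y); rewrite mlinD //.
have P Z : a (s ++ Z :: X + Y :: t) = a (s ++ Z :: X :: t) + a (s ++ Z :: Y :: t).
  by rewrite -cat_rcons mlinD // !cat_rcons.
by rewrite !P !aa add0r addr0 => ->.
Qed.

Lemma move_front a s t X : preform a ->
  a (s ++ X :: t) = (-1) ^+ size s * a (X :: s ++ t).
Proof.
move=> ga; elim/last_ind: s t => [|s Y IH] t; first by rewrite /= expr0 mul1r.
by rewrite cat_rcons swap_adj // IH cat_rcons size_rcons exprS mulN1r mulNr.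
Qed.

Lemma preform_alt a : preform a <-> multilinear a /\ alternating a.
Proof.
split=> [ga| [ma aa]]; split=> //; first by case: ga.
  move=> s t u X; rewrite -cat_cons catA move_front // -catA -cat_cons.
  rewrite cat_cons -[_ ++ u]/((X :: t) ++ u) -cat_cons.
  by rewrite (move_front (X :: s)) // (ga.2 [::]) !mulr0.
by move=> s t X; exact: (aa s [::]).
Qed.

Lemma iota_preform X a : preform a -> preform (iota X a).
Proof.
by move=> [ma aa]; split=> [s t f Y Z|s t Y]; rewrite /iota -!cat_cons.
Qed.

Lemma iota_lieder X Y a :
  iota Y (lieder X a) = lieder X (iota Y a) - iota (lie X Y) a.
Proof.
apply/funext => s; rewrite -[RHS]/(lieder X (iota Y a) s - iota (lie X Y) a s).
rewrite /iota /lieder /= big_nat_recl //= drop0 opprD addrA addrAC.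
by congr (_ - _).
Qed.

Lemma cartan X a : preform a ->
  iota X (ext_diff a) = lieder X a - ext_diff (iota X a).
Proof.
move=> ga; apply/funext => s.
rewrite -[RHS]/(lieder X a s - ext_diff (iota X a) s).
rewrite /iota /ext_diff /= big_nat_recl //= /omit /= drop0 expr0 mul1r.
rewrite big_nat_recl //= [Z in _ + (Z + _)]big_geq // add0r.
rewrite /lieder -!addrA; congr (_ + _).
rewrite opprD [RHS]addrCA; apply: (f_equal2 (fun f g : C => f + g)).
  by rewrite -sumrN; apply: eq_bigr => i _; rewrite exprS mulN1r mulNr.
rewrite -!sumrN -big_split /= !big_nat; apply: eq_bigr => j /andP[_ js].
rewrite big_nat_recl //= drop0; congr (_ + _).
  rewrite add0n exprS mulN1r mulNr; congr (- _).
  by rewrite move_front // size_take js.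
rewrite -sumrN; apply: eq_bigr => i _.
rewrite addSn addnS !exprS !mulN1r opprK -mulrN; congr (_ * _).
by rewrite -[_ :: X :: _]cat0s swap_adj.
Qed.

Lemma liederD X a b : lieder X (a + b) = lieder X a + lieder X b.
Proof.
apply/funext => s; rewrite -[RHS]/(lieder X a s + lieder X b s) /lieder.
by rewrite [(a + b) s]/(a s + b s) actD big_split /= opprD addrACA.
Qed.
Lemma liederN X a : lieder X (- a) = - lieder X a.
Proof.
apply/funext => s; rewrite -[RHS]/(- lieder X a s) /lieder.
by rewrite [(- a) s]/(- a s) actN sumrN opprB opprK addrC.
Qed.
Lemma liederB X a b : lieder X (a - b) = lieder X a - lieder X b.
Proof. by rewrite liederD liederN. Qed.
Lemma liederM X f a b s : lieder X (fun s => f * a s + b s) s =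
  act X f * a s + f * lieder X a s + lieder X b s.
Proof.
rewrite /lieder actD actM big_split /= -mulr_sumr; ring.
Qed.

Lemma ext_diffD a b : ext_diff (a + b) = ext_diff a + ext_diff b.
Proof.
apply/funext => s; rewrite -[RHS]/(ext_diff a s + ext_diff b s) /ext_diff.
rewrite [RHS]addrACA -!big_split /=; apply: eq_bigr => i _.
rewrite [(a + b) (omit i s)]/(a (omit i s) + b (omit i s)) actD mulrDr.
rewrite -big_split; congr (_ + _); apply: eq_bigr => j _; exact: mulrDr.
Qed.
Lemma ext_diffN a : ext_diff (- a) = - ext_diff a.
Proof.
apply/funext => s; rewrite -[RHS]/(- ext_diff a s) /ext_diff opprD -!sumrN.
congr (_ + _); apply: eq_bigr => i _; first by rewrite -mulrN -actN.
by rewrite -sumrN; apply: eq_bigr => j _; rewrite -mulrN.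
Qed.
Lemma ext_diffB a b : ext_diff (a - b) = ext_diff a - ext_diff b.
Proof. by rewrite ext_diffD ext_diffN. Qed.
Lemma ext_diffM_aux (K : comPzRingType) (e f u x w v A B : K) :
  e * (f * u + x * w + v) + (f * A + B) =
  e * (w * x) + (f * (e * u) + f * A) + (e * v + B).
Proof. by ring. Qed.
Lemma ext_diffM f a b s : ext_diff (fun s => f * a s + b s) s =
  \sum_(0 <= i < size s) (-1) ^+ i * (act (nth 0 s i) f * a (omit i s)) +
  f * ext_diff a s + ext_diff b s.
Proof.
rewrite /ext_diff mulrDr !mulr_sumr -!big_split /=; apply: eq_bigr => i _.
rewrite actD actM.
have -> : \sum_(0 <= j < i) (-1) ^+ (j + i) *
    (f * a (lie (nth 0 s j) (nth 0 s i) :: omit j (omit i s)) +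
     b (lie (nth 0 s j) (nth 0 s i) :: omit j (omit i s))) =
  f * \sum_(0 <= j < i) (-1) ^+ (j + i) *
     a (lie (nth 0 s j) (nth 0 s i) :: omit j (omit i s)) +
  \sum_(0 <= j < i) (-1) ^+ (j + i) *
     b (lie (nth 0 s j) (nth 0 s i) :: omit j (omit i s)).
  rewrite mulr_sumr -big_split /=; apply: eq_bigr => j _.
  by rewrite mulrDr mulrCA.
set A := \sum_(_ <= _ < _) _; set B := \sum_(_ <= _ < _) _.
exact: ext_diffM_aux.
Qed.

Lemma iota_lin a f X Y : multilinear a ->
  iota (f *: X + Y) a = (fun s => f * iota X a s + iota Y a s).
Proof. by move=> ma; apply/funext => s; apply: (ma [::]). Qed.

Lemma lieder_cons X Y a s : lieder X a (Y :: s) =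
  lieder X (iota Y a) s - a (lie X Y :: s).
Proof. by have /(congr1 (@^~ s)) := iota_lieder X Y a. Qed.

Lemma ext_diff_cons X a s : preform a -> ext_diff a (X :: s) =
  lieder X a s - ext_diff (iota X a) s.
Proof. by move=> ga; have /(congr1 (@^~ s)) := cartan X ga. Qed.

Lemma lieder_preform X a : preform a -> preform (lieder X a).
Proof.
move=> ga; split.
  move=> s; elim: s a ga => [|W s IH] a ga t f Y Z.
    rewrite /= !lieder_cons (iota_lin _ _ _ ga.1) liederM lieZr.
    have eD A B : a (A + B :: t) = a (A :: t) + a (B :: t).
      exact: (mlinD [::]) ga.1.
    have eZ g A : a (g *: A :: t) = g * a (A :: t).
      exact: (mlinZ [::]) ga.1.
    by rewrite !eD !eZ /iota; ring.
  rewrite /= !lieder_cons IH; last exact: iota_preform.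
  by rewrite -!cat_cons ga.1; ring.
move=> s; elim: s a ga => [|W s IH] a ga t Y.
  have iYY : iota Y (iota Y a) = 0 by apply/funext => u; apply: (ga.2 [::]).
  rewrite /= !lieder_cons iYY (swap_adj [::]) //= /iota.
  rewrite opprK subrK /lieder big1 ?subr0 //=; exact: act0.
rewrite /= lieder_cons IH; last exact: iota_preform.
by rewrite -cat_cons ga.2 subr0.
Qed.

Lemma ext_diff_preform a : preform a -> preform (ext_diff a).
Proof.
move=> ga; split.
  move=> s; elim: s a ga => [|W s IH] a ga t f Y Z; last first.
    have gl := lieder_preform W ga.
    rewrite /= !ext_diff_cons // IH; last exact: iota_preform.
    by rewrite gl.1; ring.
  rewrite /= !ext_diff_cons // (iota_lin _ _ _ ga.1) ext_diffM.
  have -> : lieder (f *: Y + Z) a t = f * lieder Y a t + lieder Z a t +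
      \sum_(0 <= i < size t) (-1) ^+ i * (act (nth 0 t i) f * iota Y a (omit i t)).
    rewrite /lieder actP.
    have -> : \sum_(0 <= j < size t) a
        (take j t ++ lie (f *: Y + Z) (nth 0 t j) :: drop j.+1 t) =
      f * (\sum_(0 <= j < size t)
            a (take j t ++ lie Y (nth 0 t j) :: drop j.+1 t)) -
      \sum_(0 <= i < size t)
         (-1) ^+ i * (act (nth 0 t i) f * iota Y a (omit i t)) +
      \sum_(0 <= j < size t)
         a (take j t ++ lie Z (nth 0 t j) :: drop j.+1 t).
      rewrite mulr_sumr -sumrN -!big_split /= !big_nat.
      apply: eq_bigr => j /andP[_ jt].
      rewrite lieZl (mlinD _ _ _ _ ga.1) (mlinD _ _ _ _ ga.1) (mlinN _ _ _ ga.1).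
      rewrite !(mlinZ _ _ _ _ ga.1).
      by rewrite (move_front _ _ Y) // size_take jt /iota /omit; ring.
    by ring.
  by ring.
move=> s; elim: s a ga => [|W s IH] a ga t Y; last first.
  rewrite /= ext_diff_cons // IH; last exact: iota_preform.
  by rewrite (lieder_preform W ga).2 subr0.
have iYY : iota Y (iota Y a) = 0 by apply/funext => u; apply: (ga.2 [::]).
have gi := iota_preform Y ga.
rewrite /= !ext_diff_cons // iYY lieder_cons lieXX.
rewrite (mlin0 [::] _ ga.1) subr0 opprB addrC subrK.
by rewrite -(subrr (0 : raw)) ext_diffB subrr.
Qed.

Lemma lieder_lie X Y a : preform a ->
  lieder X (lieder Y a) - lieder Y (lieder X a) = lieder (lie X Y) a.
Proof.
move=> ga; apply/funext => s.
rewrite -[LHS]/(lieder X (lieder Y a) s - lieder Y (lieder X a) s).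
elim: s a ga => [|Z s IH] a ga.
  by rewrite /lieder /= !big_geq // !subr0; exact: act_lie.
have aD A B : a (A + B :: s) = a (A :: s) + a (B :: s).
  exact: (mlinD [::]) ga.1.
rewrite !lieder_cons !iota_lieder (liederB X (lieder Y _)) (liederB Y (lieder X _)) -(IH _ (iota_preform Z ga)).
rewrite -[(lieder X (lieder Y (iota Z a)) - _) s]/(_ - _).
rewrite -[(lieder Y (lieder X (iota Z a)) - _) s]/(_ - _).
by rewrite (jacobi X) aD; ring.
Qed.

Lemma lieder_ext_diff X a : preform a ->
  lieder X (ext_diff a) = ext_diff (lieder X a).
Proof.
move=> ga; apply/funext => s; elim: s a X ga => [|Y s IH] a X ga.
  by rewrite /lieder /ext_diff /= !big_geq // addr0 act0 subr0.
have gi Z := iota_preform Z ga; have gl Z := lieder_preform Z ga.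
rewrite lieder_cons (ext_diff_cons _ _ (gl _)) cartan // liederB.
rewrite -[ext_diff a (lie X Y :: s)]/(iota (lie X Y) (ext_diff a) s) cartan //.
rewrite iota_lieder ext_diffB -lieder_lie //.
rewrite -[LHS]/(lieder X (lieder Y a) s - lieder X (ext_diff (iota Y a)) s -
  (lieder X (lieder Y a) s - lieder Y (lieder X a) s -
   ext_diff (iota (lie X Y) a) s)).
rewrite -[RHS]/(lieder Y (lieder X a) s - (ext_diff (lieder X (iota Y a)) s -
   ext_diff (iota (lie X Y) a) s)).
by rewrite IH //; ring.
Qed.

Lemma ext_diffK a : preform a -> ext_diff (ext_diff a) = 0.
Proof.
move=> ga; apply/funext => s; elim: s a ga => [|X s IH] a ga.
  by rewrite /ext_diff /= !big_geq ?addr0.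
rewrite ext_diff_cons; last exact: ext_diff_preform.
rewrite cartan // ext_diffB lieder_ext_diff //.
rewrite -[(ext_diff (lieder X a) - _) s]/(ext_diff (lieder X a) s - 
  ext_diff (ext_diff (iota X a)) s) (IH _ (iota_preform X ga)).
by rewrite subr0 subrr.
Qed.

End Forms.

Section DifferentialForms.
Context (R : realType) (M : manifold R).
Local Notation C := (Cinf M).

Definition vfields : lieRinehart C :=
  @LieRinehart C (vfield M) (fun X f => X f) (@bracket R M) (@vfD R M)
    (@vfM R M) (fun _ _ _ _ => erefl) (fun _ _ _ => erefl) (@bracketXX R M)
    (@bracketN R M) (@bracketZr R M) (@bracket_jacobi R M).

Definition is_form : {pred (seq vfields -> C)} :=
  [pred a : seq vfields -> C | `[< multilinear a /\ alternating a >]].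

Lemma is_formP (a : seq vfields -> C) : reflect (preform a) (a \in is_form).
Proof. by apply: (iffP (asboolP _)) => /preform_alt. Qed.

Lemma is_form_submod : GRing.submod_closed is_form.
Proof.
split=> [|c a b /asboolP[ma aa] /asboolP[mb ab]]; apply/asboolP; split.
- by move=> s t f X Y; rewrite -[RHS]/(f * 0 + 0) mulr0 addr0.
- by [].
- move=> s t f X Y; rewrite -[LHS]/(c *: a _ + b _) ma mb.
  rewrite -[RHS]/(f * (c *: a _ + b _) + (c *: a _ + b _)).
  by rewrite scalerDr CinfZ mulrDr addrACA.
- by move=> s t u X; rewrite -[LHS]/(c *: a _ + b _) aa ab scaler0 addr0.
Qed.
HB.instance Definition _ :=
  GRing.isSubmodClosed.Build R (seq vfields -> C) is_form is_form_submod.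

Record Omega := Form { form_val :> seq vfields -> C; formP : form_val \in is_form }.
HB.instance Definition _ := [isSub for form_val].
HB.instance Definition _ := [Choice of Omega by <:].
HB.instance Definition _ := [SubChoice_isSubLmodule of Omega by <:].

Lemma dOmega_subproof (a : Omega) : ext_diff a \in is_form.
Proof. by apply/is_formP/ext_diff_preform/is_formP/formP. Qed.
Definition dOmega (a : Omega) : Omega := Form (dOmega_subproof a).

Lemma contract_subproof X (a : Omega) : iota X a \in is_form.
Proof. by apply/is_formP/iota_preform/is_formP/formP. Qed.
Definition contract X (a : Omega) : Omega := Form (contract_subproof X a).

Definition component_fun (p : nat) (a : Omega) : seq vfields -> C :=
  fun s => if size s == p then a s else 0.
Lemma component_subproof p (a : Omega) : component_fun p a \in is_form.
Proof.
have /asboolP[ma aa] := formP a; apply/asboolP; split=> [s t f X Y|s t u X].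
  by rewrite /component_fun !size_cat /=; case: eqP; rewrite ?mulr0 ?addr0.
by rewrite /component_fun aa if_same.
Qed.
Definition component p (a : Omega) : Omega := Form (component_subproof p a).

Definition is_homogeneous (p : nat) (a : Omega) : Prop :=
  forall s, size s != p -> a s = 0.

Record dform (p : nat) := DForm {
  dform_val :> Omega;
  dform_homogeneous : is_homogeneous p dform_val
}.

(* Non-degeneracy is a condition on tangent vectors at each point [x]. Every
   tangent vector at [x] is the value at [x] of some vector field [X], so it can
   be tested on the values of vector fields. *)
Record nplectic (n : nat) := NPlectic {
  npl_form :> dform n.+1;
  npl_gt0 : (0 < n)%N;
  npl_closed : dOmega npl_form = 0;
  npl_nondegenerate : forall (x : M) (X : vfields),
    (forall s, (npl_form (X :: s) : C) x = 0) -> forall f : C, (act X f) x = 0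
}.

Definition hamiltonian n (omega : nplectic n) (a : Omega) : Prop :=
  exists X : vfields, dOmega a = - contract X omega.

End DifferentialForms.

(* Graded vector spaces with finitely many non-zero components, as the direct
   sum [gvect] with the projections [gproj i] on the components, of degree
   [gdeg i]. *)
Record gradedSpace (R : realType) := GradedSpace {
  gvect :> lmodType R;
  gindex : finType;
  gdeg : gindex -> int;
  gproj : gindex -> gvect -> gvect;
  gdeg_inj : injective gdeg;
  gproj_linear : forall i (c : R) x y,
    gproj i (c *: x + y) = c *: gproj i x + gproj i y;
  gprojK : forall i j x, gproj i (gproj j x) = if i == j then gproj i x else 0;
  gproj_sum : forall x, \sum_i gproj i x = x
}.

Section VectorValuedForms.
Context (R : realType) (V : gradedSpace R).

(* A formal sum of vector valued k-forms: the k-form in the sum is the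
   restriction to the lists of size [k]. *)
Definition vvform := seq V -> V.

Definition of_degree (e : int) (x : V) : Prop :=
  forall i : gindex V, gdeg i != e -> gproj i x = 0.

Definition is_vvform (delta : int) (K : vvform) : Prop :=
  [/\ forall (s t : seq V) (c : R) (x y : V),
        K (s ++ (c *: x + y) :: t) = c *: K (s ++ x :: t) + K (s ++ y :: t),
      forall (s t : seq V) (e e' : int) (x y : V),
        of_degree e x -> of_degree e' y ->
        K (s ++ x :: y :: t) = (-1) ^ (e * e') *: K (s ++ y :: x :: t) &
      forall (s : seq V) (e : 'I_(size s) -> int),
        (forall i, of_degree (e i) (tnth (in_tuple s) i)) ->
        of_degree (\sum_i e i + delta) (K s)].

(* [sigma] belongs to Sh(k, m - k). *)
Definition unshuffle (m k : nat) (sigma : 'S_m) : bool :=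
  [forall i : 'I_m, forall j : 'I_m,
    (i < j)%N && ((j < k) || (k <= i))%N ==> (sigma i < sigma j)%N].

(* The sign of [X_1 ... X_m = +/- X_(sigma 1) ... X_(sigma m)] in the graded
   symmetric algebra, where [X_i] has degree [e i]. *)
Definition koszul_sign (m : nat) (e : 'I_m -> int) (sigma : 'S_m) : R :=
  \prod_(i < m) \prod_(j < m | (i < j)%N && (sigma j < sigma i)%N)
    (-1) ^ (e (sigma i) * e (sigma j)).

(* Since the Koszul sign requires homogeneous arguments, each argument is
   expanded along its homogeneous components, [e] being the choice of one
   component for each argument. All arities of [K] and [L] are summed; the
   component of [L] of arity 0 is never used. *)
Definition insertion (K L : vvform) : vvform := fun s =>
  \sum_(e : {ffun 'I_(size s) -> gindex V})
  \sum_(k < (size s).+1)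
  \sum_(sigma : 'S_(size s) | unshuffle k sigma)
    koszul_sign (fun i => gdeg (e i)) sigma *:
      let t := [seq gproj (e (sigma i)) (tnth (in_tuple s) (sigma i))
               | i <- enum 'I_(size s)] in
      L (K (take k t) :: drop k t).

(* The bracket of a form of degree [degK] with a form of degree [degL]. *)
Definition RN_bracket (degK degL : int) (K L : vvform) : vvform :=
  insertion K L - (-1) ^ (degK * degL) *: insertion L K.

(* [mu] is meant to be of degree 1. *)
Definition nijenhuis (mu N : vvform) : Prop :=
  is_vvform 0 N /\
  exists K : vvform, [/\ is_vvform 0 K,
    RN_bracket 0 1 N (RN_bracket 0 1 N mu) = RN_bracket 0 1 K mu &
    RN_bracket 0 0 N K = 0].

Definition euler : vvform := fun s =>
  if s is [:: x] then \sum_i - (gdeg i)%:~R *: gproj i x else 0.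

End VectorValuedForms.

Arguments euler {R} V.

Section AssociatedLieAlgebra.
Context (R : realType) (M : manifold R) (n : nat) (omega : nplectic M n).
Local Notation C := (Cinf M).
Local Notation V := (vfields M).

(* The sum of the forms of degrees 0, ..., n - 1 whose component of degree n - 1
   is Hamiltonian. Forms of degree [p] have degree [p - n] in [E]. *)
Definition in_E : {pred Omega M} := [pred a : Omega M | `[<
  (forall s, (n <= size s)%N -> a s = 0) /\
  hamiltonian omega (component n.-1 a) >]].

Lemma Omega_eq (a b : Omega M) : (forall s, a s = b s) -> a = b.
Proof. by move=> ab; apply/val_inj/funext. Qed.

Lemma formDZE c (a b : Omega M) s : (c *: a + b) s = c *: a s + b s.
Proof. by []. Qed.

Lemma preformP (a : Omega M) : preform a.
Proof. exact/is_formP/formP. Qed.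

Definition cfun (c : R) : C := c *: (1 : C).

Lemma const_mul (c : R) (f : C) : cfun c * f = c *: f.
Proof. by rewrite mulrC -CinfZ mulr1. Qed.

Lemma dOmega_linear c (a b : Omega M) : dOmega (c *: a + b) = c *: dOmega a + dOmega b.
Proof.
apply: Omega_eq => s; rewrite formDZE /=.
have -> : c *: (a : seq V -> C) + b = fun s => cfun c * a s + b s.
  by apply/funext => t; rewrite const_mul.
rewrite ext_diffM const_mul big1 ?add0r // => i _.
set X := nth 0 s i; suff -> : act X (cfun c) = 0 by rewrite mul0r mulr0.
have X1 : act X 1 = 0.
  by apply: (@addIr _ (act X 1)); rewrite add0r -[in RHS](mulr1 1) actM !mul1r.
by rewrite /cfun -[c *: _]addr0 [LHS](vfP X) (vf0 X) addr0 [X 1]X1 scaler0.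
Qed.

Lemma component_linear p c (a b : Omega M) :
  component p (c *: a + b) = c *: component p a + component p b.
Proof.
apply: Omega_eq => s; rewrite formDZE /= /component_fun.
by case: eqP; rewrite ?formDZE ?scaler0 ?addr0.
Qed.

Lemma hamiltonian_linear c (a b : Omega M) :
  hamiltonian omega a -> hamiltonian omega b -> hamiltonian omega (c *: a + b).
Proof.
move=> [X dX] [Y dY]; exists (cfun c *: X + Y).
rewrite dOmega_linear dX dY scalerN -opprD; congr (- _); apply: Omega_eq => s.
rewrite formDZE /= /iota -const_mul.
by rewrite ((preformP omega).1 [::]).
Qed.

Lemma dOmega0 : dOmega (0 : Omega M) = 0.
Proof. by have := dOmega_linear (-1) 0 0; rewrite scaler0 addr0 scaleN1r addNr. Qed.

Lemma contract0 (a : Omega M) : contract 0 a = 0.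
Proof. by apply: Omega_eq => s; exact: (mlin0 [::] _ (preformP a).1). Qed.

Lemma hamiltonian_closed (a : Omega M) : dOmega a = 0 -> hamiltonian omega a.
Proof. by exists 0; rewrite contract0 oppr0. Qed.

Lemma in_E_submod : GRing.submod_closed in_E.
Proof.
split=> [|c a b /asboolP[sa ha] /asboolP[sb hb]]; apply/asboolP; split.
- by [].
- apply: hamiltonian_closed; rewrite -[RHS]dOmega0; congr dOmega; apply: Omega_eq => s.
  by rewrite /= /component_fun if_same.
- by move=> s ns; rewrite formDZE sa // sb // scaler0 addr0.
- by rewrite component_linear; exact: hamiltonian_linear.
Qed.
HB.instance Definition _ := GRing.isSubmodClosed.Build R (Omega M) in_E in_E_submod.

Record E_carrier := MkE { E_val :> Omega M; E_valP : E_val \in in_E }.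
HB.instance Definition _ := [isSub for E_val].
HB.instance Definition _ := [Choice of E_carrier by <:].
HB.instance Definition _ := [SubChoice_isSubLmodule of E_carrier by <:].

Lemma component_component p q (a : Omega M) :
  component p (component q a) = if p == q then component p a else 0.
Proof.
apply: Omega_eq => s; rewrite /= /component_fun /= /component_fun.
have [->|pq] := eqVneq p q; first by rewrite /= /component_fun; case: eqP.
by case: eqP => // ->; rewrite (negPf pq).
Qed.

Lemma in_E_low (a : Omega M) :
  (forall s, (n.-1 <= size s)%N -> a s = 0) -> a \in in_E.
Proof.
move=> sa; apply/asboolP; split=> [s ns|].
  by rewrite sa // (leq_trans (leq_pred n)).
apply: hamiltonian_closed; rewrite -dOmega0; congr dOmega; apply: Omega_eq => s.
by rewrite /= /component_fun; case: eqP => // e; rewrite sa // e.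
Qed.

Lemma E_proj_subproof (p : 'I_n) (a : E_carrier) : component p a \in in_E.
Proof.
have /asboolP[sa ha] := E_valP a.
apply/asboolP; split=> [s ns|].
  by rewrite /= /component_fun sa // if_same.
rewrite component_component; case: eqP => [_|_]; first exact: ha.
by apply: hamiltonian_closed; rewrite dOmega0.
Qed.
Definition E_proj (p : 'I_n) (a : E_carrier) : E_carrier :=
  MkE (E_proj_subproof p a).

Definition E_deg (p : 'I_n) : int := p%:Z - n%:Z.

Lemma E_deg_inj : injective E_deg.
Proof. by move=> p q /addIr[] /val_inj. Qed.

Lemma E_eq (a b : E_carrier) : (forall s, a s = b s) -> a = b.
Proof. by move=> ab; apply/val_inj/Omega_eq. Qed.

Lemma E_proj_linear p (c : R) a b :
  E_proj p (c *: a + b) = c *: E_proj p a + E_proj p b.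
Proof. by apply/val_inj; exact: component_linear. Qed.

Lemma E_projK p q a : E_proj p (E_proj q a) = if p == q then E_proj p a else 0.
Proof.
apply/val_inj; rewrite /= component_component -val_eqE.
by case: (val p == val q).
Qed.

Lemma E_sumE I (r : seq I) (F : I -> E_carrier) s :
  (\sum_(i <- r) F i : E_carrier) s = \sum_(i <- r) F i s.
Proof. by elim/big_rec2: _ => // i f a _ <-. Qed.

Lemma E_proj_sum a : \sum_p E_proj p a = a.
Proof.
apply: E_eq => s; rewrite E_sumE /= /component_fun.
have [sn|sn] := ltnP (size s) n.
  rewrite (bigD1 (Ordinal sn)) //= eqxx big1 ?addr0 // => p.
  by rewrite -val_eqE /= eq_sym => /negPf->.
have /asboolP[sa _] := E_valP a; rewrite (sa s) // big1 // => p _.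
by rewrite if_same.
Qed.

Definition E : gradedSpace R :=
  @GradedSpace R E_carrier 'I_n E_deg E_proj E_deg_inj E_proj_linear
    E_projK E_proj_sum.

Lemma ham_vfield_exists (a : E) :
  exists X : V, dOmega (component n.-1 (a : E_carrier)) = - contract X omega.
Proof. by have /asboolP[] := E_valP a. Qed.

(* The Hamiltonian vector field of the component of [a] in E_{-1}; it is unique
   since [omega] is non-degenerate. *)
Definition ham_vfield (a : E) : V := sval (cid (ham_vfield_exists a)).

Lemma size_omit i (s : seq V) : (i < size s)%N -> size (omit i s) = (size s).-1.
Proof.
move=> si; rewrite size_cat size_take si size_drop.
by case: (size s) si => // m; rewrite ltnS subSS => /subnKC.
Qed.

Lemma dOmega_homogeneous p (a : Omega M) :
  is_homogeneous p a -> is_homogeneous p.+1 (dOmega a).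
Proof.
move=> ha s sp; rewrite /= /ext_diff !big_nat.
rewrite [X in X + _]big1 ?add0r => [|i /andP[_ si]]; last first.
  rewrite ha ?act0 ?mulr0 // size_omit //.
  by apply: contraNneq sp => <-; rewrite prednK // (leq_ltn_trans _ si).
rewrite big1 // => j /andP[_ sj]; rewrite big_nat big1 // => i /andP[_ ij].
have ij' : (i < size (omit j s))%N.
  by rewrite size_omit // (leq_trans ij) // -ltnS prednK // (leq_ltn_trans _ sj).
rewrite ha ?mulr0 //= size_omit // size_omit //.
apply: contraNneq sp => <-; case: (size s) sj => // -[|m] //=.
by rewrite ltnS leqn0 => /eqP j0; rewrite j0 in ij.
Qed.

Lemma component_homogeneous p (a : Omega M) : is_homogeneous p (component p a).
Proof. by move=> s sp; rewrite /= /component_fun (negPf sp). Qed.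

Lemma component_id p q (a : Omega M) : is_homogeneous p a ->
  component q a = if p == q then a else 0.
Proof.
move=> ha; apply: Omega_eq => s; rewrite /= /component_fun.
case: (eqVneq p q) => [<-|pq].
  by case: (eqVneq (size s) p) => // /ha.
by case: (eqVneq (size s) q) => // sq; rewrite ha // sq eq_sym.
Qed.

Lemma dOmegaK (a : Omega M) : dOmega (dOmega a) = 0.
Proof. by apply: Omega_eq => s; rewrite /= (ext_diffK (preformP a)). Qed.

(* The term [p = n - 1], which is the component in E_{-1}, is left out. *)
Lemma l1_subproof (a : E) : \sum_(p < n.-1)
  (-1) ^ (p%:Z - n%:Z) *: dOmega (component p (a : E_carrier)) \in in_E.
Proof.
apply: rpred_sum => p _; apply: rpredZ.
have hd := dOmega_homogeneous (@component_homogeneous p (a : E_carrier)).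
apply/asboolP; split=> [s ns|].
  rewrite hd // gtn_eqF // (leq_trans _ ns) //.
  by rewrite -[leqRHS](prednK (npl_gt0 omega)) ltnS.
apply: hamiltonian_closed; rewrite (component_id _ hd).
by case: eqP => _; rewrite ?dOmegaK ?dOmega0.
Qed.
Definition l1 (a : E) : E := MkE (l1_subproof a).

Definition contractions (s : seq V) (a : Omega M) : Omega M :=
  foldr (@contract R M) a s.

Lemma contractionsE s (a : Omega M) t : contractions s a t = a (rev s ++ t).
Proof.
elim: s t => [//|X s IH] t.
by rewrite -[LHS]/(contractions s a (X :: t)) IH rev_cons cat_rcons.
Qed.

Lemma contractions0 p s (a : Omega M) t : is_homogeneous p a ->
  (size s + size t != p)%N -> contractions s a t = 0.
Proof. by move=> ha st; rewrite contractionsE ha // size_cat size_rev. Qed.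

Lemma contract_ham_closed (a : E) : dOmega (contract (ham_vfield a) omega) = 0.
Proof.
have e := svalP (cid (ham_vfield_exists a)).
have -> : contract (ham_vfield a) omega =
    -1 *: dOmega (component n.-1 (a : E_carrier)) + 0.
  by rewrite e scaleN1r opprK addr0.
by rewrite dOmega_linear dOmegaK dOmega0 scaler0 addr0.
Qed.

Lemma dOmega_contract2 (X Y : V) :
  dOmega (contract X omega) = 0 -> dOmega (contract Y omega) = 0 ->
  dOmega (contract X (contract Y omega)) = contract (lie X Y) omega.
Proof.
move=> dX dY; apply/val_inj => /=; have g := preformP omega.
have dXo : lieder X (omega : seq V -> C) = 0.
  have := cartan X g; have := congr1 val (npl_closed omega) => /= ->.
  have := congr1 val dX => /= ->; rewrite subr0 => <-.
  by [].
have := cartan X (iota_preform Y g); have := congr1 val dY => /= ->.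
have : iota Y (lieder X omega) = 0 by rewrite dXo.
rewrite iota_lieder => /eqP; rewrite subr_eq0 => /eqP ->.
by move=> /eqP; rewrite eq_sym subr_eq0 => /eqP.
Qed.

Definition l_sign (k : nat) : R :=
  if odd k then (-1) ^+ k.-1./2 else (-1) ^+ (k./2.+1).

(* As [ham_vfield] only sees the component in E_{-1}, this is the multilinear map
   which vanishes as soon as a homogeneous argument is not in E_{-1}. It is l_k
   for [k = size s >= 2]. *)
Definition lk_fun (s : seq E) : Omega M := if (1 < size s)%N then
  l_sign (size s) *: contractions (map ham_vfield s) omega else 0.

Lemma lk_subproof (s : seq E) : lk_fun s \in in_E.
Proof.
rewrite /lk_fun; case: ifP => [s1|_]; last exact: rpred0.
apply: rpredZ; have n0 := npl_gt0 omega; have ho := dform_homogeneous omega.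
have [s2|s2] := ltnP 2 (size s).
  apply: in_E_low => t nt; rewrite (contractions0 ho) // size_map gtn_eqF //.
  by rewrite -(prednK n0) -addn3 addnC leq_add.
case: s s1 s2 => [|a [|b []]] // _ _.
apply/asboolP; split=> [t nt|].
  by rewrite (contractions0 ho) // gtn_eqF //= !ltnS.
have hc : is_homogeneous n.-1 (contractions (map ham_vfield [:: a; b]) omega).
  move=> t tn; rewrite (contractions0 ho) //= add2n eqSS.
  by apply: contraNneq tn => <-.
rewrite (component_id _ hc) eqxx; exists (- lie (ham_vfield a) (ham_vfield b)).
rewrite /= dOmega_contract2 ?contract_ham_closed //; apply: Omega_eq => t.
rewrite -[RHS]/(- omega (- lie (ham_vfield a) (ham_vfield b) :: t)).
by rewrite (mlinN [::] _ _ (preformP omega).1) opprK.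
Qed.

Definition l_ (k : nat) : vvform E := fun s =>
  if size s == k then
    if s is [:: a] then l1 a else MkE (lk_subproof s)
  else 0.

Definition lie_n_algebra : vvform E := \sum_(1 <= k < n.+2) l_ k.

(* The guard [1 < size s] makes the value belong to [E]. *)
Definition eta_fun (eta : dform M n) (s : seq E) : Omega M :=
  if (1 < size s)%N then contractions (map ham_vfield s) eta else 0.

Lemma eta_subproof (eta : dform M n) (s : seq E) : eta_fun eta s \in in_E.
Proof.
rewrite /eta_fun; case: ifP => [s1|_]; last exact: rpred0.
apply: in_E_low => t nt; rewrite (contractions0 (dform_homogeneous eta)) //.
rewrite size_map gtn_eqF // -(prednK (npl_gt0 omega)) -add2n.
exact: leq_add.
Qed.

Definition eta_tilde (eta : dform M n) (i : nat) : vvform E := fun s =>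
  if size s == i then MkE (eta_subproof eta s) else 0.

(* [T] is the sum of the [F j], for [j >= 1], in the sense that evaluating the
   partial sums on elements of [E], then on vector fields, then at a point,
   yields a convergent sequence of real numbers. *)
Definition vvseries (F : nat -> vvform E) (T : vvform E) : Prop :=
  forall (s : seq E) (Xs : seq V) (x : M),
    (fun J : nat => ((\sum_(1 <= j < J) F j) s : E_carrier) Xs x : R) @ \oo
      --> ((T s : E_carrier) Xs x : R).

End AssociatedLieAlgebra.

Arguments lie_n_algebra {R M n} omega.
Arguments eta_tilde {R M n} omega eta i.

(* Main.v *)
Require Import Defs.
From HB Require Import structures.
From mathcomp Require Import all_boot all_order all_algebra.
From mathcomp Require Import fingroup perm zify.
From mathcomp Require Import all_classical all_reals all_analysis.
Set Implicit Arguments.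
Unset Strict Implicit.
Unset Printing Implicit Defensive.
Import Order.TTheory GRing.Theory Num.Theory.
Local Open Scope ring_scope.

(* Let [A] be the sum of the forms induced by the [eta j]. Bracketing with the
   Euler map [S] multiplies a form by its degree, so [[S, mu] = mu], [[S, A] = 0]
   and [[S, [A, mu]] = [A, mu]]. Moreover [[A, [A, mu]] = 0]: with [Z] the space
   of elements whose Hamiltonian vector field vanishes, [A] is valued in [Z] and
   vanishes when an argument is in [Z], while [l_1] is valued in [Z] and [l_k],
   for [k >= 2], vanishes when an argument is in [Z]. Hence
   [[S + A, [S + A, mu]] = mu + 2 [A, mu] = [S + 2 A, mu]], and [S + A] commutes
   with [S + 2 A]. *)

(** * Permutations and Koszul signs *)

(** That [[S, L]] is [L] times its degree is proved for graded symmetric [L]: the terms of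
    [insertion (euler V) L] become multiples of one value of [L] only by moving arguments back into
    place. The rule is applied to [[A, mu]] as well as to [mu] and [A], so brackets have to be shown
    linear, graded symmetric and of the right degree. Graded symmetry of [insertion] is the costly
    point and the reason for the study of permutations; it suffices to treat exchanges of adjacent
    arguments.

    The sum over [j] converges only in a weak sense, after evaluation on elements of [E], on vector
    fields and at a point. Hence neither the differential nor a bracket is passed to the limit. The
    argument uses [A] only through linearity, symmetry, degree, vanishing on [Z] and absence of a
    component in E_{-1}; these are linear relations between evaluations, so they survive the
    limit. *)

Section Permutations.
Context (R : realType).

Lemma signz_sqr (z : int) : (-1) ^ z * (-1) ^ z = 1 :> R.
Proof. by rewrite -exprzMl ?unitrN1 // mulrNN mulr1 exp1rz. Qed.

(** Compares two Koszul signs whose sets of inversions differ in the single pair [p]. The factor at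
    [p] is its own inverse, so it does not matter which of the two sets contains [p]. *)
Lemma prod_toggle (I : finType) (P Q : pred I) (f : I -> R) (p : I) :
  (forall q, q != p -> P q = Q q) -> P p = ~~ Q p -> f p * f p = 1 ->
  \prod_(q | P q) f q = f p * \prod_(q | Q q) f q.
Proof.
move=> PQ Pp ff.
have e : \prod_(q | P q && (q != p)) f q = \prod_(q | Q q && (q != p)) f q.
  by apply: eq_bigl => q; have [->|/PQ ->] := eqVneq q p; rewrite ?andbF ?andbT.
case Qp : (Q p).
  rewrite [in RHS](bigD1 p) //= mulrA ff mul1r -e; apply: eq_bigl => q.
  by have [->|] := eqVneq q p; rewrite ?andbT ?andbF // Pp Qp.
rewrite (bigD1 p) /=; last by rewrite Pp Qp.
rewrite e; congr (_ * _); apply: eq_bigl => q.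
by have [->|] := eqVneq q p; rewrite ?andbT ?andbF // Qp.
Qed.

(** No value lies strictly between [i] and [i + 1], so exchanging them reverses no other
    comparison. *)
Lemma ltn_tperm m (i j x y : 'I_m) : j = i.+1 :> nat ->
  (x, y) != (i, j) -> (x, y) != (j, i) -> (tperm i j x < tperm i j y)%N = (x < y)%N.
Proof.
rewrite !xpair_eqE => ij.
by case: tpermP => [->|->|/eqP + /eqP +]; case: tpermP => [->|->|/eqP + /eqP +];
  rewrite ?eqxx -?val_eqE /=; lia.
Qed.

Lemma koszul_signE m (d : 'I_m -> int) (sigma : 'S_m) :
  koszul_sign R d sigma =
  \prod_(p : 'I_m * 'I_m | (p.1 < p.2)%N && (sigma p.2 < sigma p.1)%N)
     (-1) ^ (d (sigma p.1) * d (sigma p.2)).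
Proof. by rewrite /koszul_sign pair_big_dep. Qed.

Lemma koszul_sign1 m (d : 'I_m -> int) : koszul_sign R d 1%g = 1.
Proof. by rewrite koszul_signE big1 // => -[x y] /=; rewrite !perm1; lia. Qed.

(** The exchange acts on values: the inversions of [sigma] and of [sigma * tperm i j] differ only in
    the pair of positions where [sigma] takes the values [i] and [j]. *)
Lemma koszul_sign_tpermr m (d : 'I_m -> int) (sigma : 'S_m) (i j : 'I_m) :
  j = i.+1 :> nat ->
  koszul_sign R (d \o tperm i j) sigma =
  (-1) ^ (d i * d j) * koszul_sign R d (sigma * tperm i j)%g.
Proof.
move=> ij; rewrite !koszul_signE.
set a := (sigma^-1 i)%g; set b := (sigma^-1 j)%g.
have ea : sigma a = i by rewrite permKV.
have eb : sigma b = j by rewrite permKV.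
pose p := if (a < b)%N then (a, b) else (b, a).
have ab : a != b :> nat.
  rewrite (inj_eq val_inj); apply/eqP => e; by move: ij; rewrite -ea -eb e; lia.
rewrite (prod_toggle (p := p) (Q := fun p : 'I_m * 'I_m => (p.1 < p.2)%N &&
    ((sigma * tperm i j)%g p.2 < (sigma * tperm i j)%g p.1)%N)).
- congr (_ * _); last by apply: eq_bigr => q _; rewrite !permM.
  by rewrite /p; case: ifP => _; rewrite /= ea eb tpermL tpermR // mulrC.
- case=> x y xy; rewrite /= !permM; case xy': (x < y)%N => //=.
  have xy1 u v : sigma a = u -> sigma b = v -> (x, y) != p -> ((sigma y, sigma x) != (v, u)).
    move=> <- <-; rewrite /p !xpair_eqE; apply: contra.
    move=> /andP[/eqP/perm_inj eb' /eqP/perm_inj ea'].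
    by rewrite -eb' -ea' xy' !eqxx.
  rewrite ltn_tperm //.
    rewrite xpair_eqE -{1}ea -{1}eb !(inj_eq perm_inj) -(xpair_eqE y).
    apply: contraNN xy => /eqP[ya xb]; rewrite /p -ya -xb.
    by rewrite ltnNge (ltnW xy').
  by apply: xy1.
- rewrite /p; case: ifP => ab'; rewrite /= !permM ?ea ?eb ?tpermL ?tpermR; lia.
- exact: signz_sqr.
Qed.

(** Here the exchange acts on positions; after reindexing the pairs of positions by it, only the
    order of [a] and [b] differs. *)
Lemma koszul_sign_tperml m (d : 'I_m -> int) (sigma : 'S_m) (a b : 'I_m) :
  b = a.+1 :> nat ->
  koszul_sign R d (tperm a b * sigma)%g =
  (-1) ^ (d (sigma a) * d (sigma b)) * koszul_sign R d sigma.
Proof.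
move=> ab; rewrite !koszul_signE.
pose t (p : 'I_m * 'I_m) := (tperm a b p.1, tperm a b p.2).
have tK : involutive t by case=> x y; rewrite /t /= !tpermK.
rewrite (reindex_inj (inv_inj tK)) /=.
(* Of the two orderings of [a] and [b], the one that meets the condition on the values of
   [sigma]. *)
pose p := if (sigma a < sigma b)%N then (b, a) else (a, b).
have sab : sigma a != sigma b :> nat.
  by rewrite (inj_eq val_inj) (inj_eq perm_inj) -val_eqE /= ab; lia.
under eq_bigr do rewrite !permM !tpermK.
rewrite (prod_toggle (p := p)
  (Q := fun p : 'I_m * 'I_m => (p.1 < p.2)%N && (sigma p.2 < sigma p.1)%N)).
- by congr (_ * _); rewrite /p; case: ifP => _ //=; rewrite mulrC.
- case=> x y; rewrite /= !permM !tpermK => xy.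
  case sxy: (sigma y < sigma x)%N; rewrite ?andbF ?andbT //; apply: ltn_tperm => //.
    apply: contraNneq xy => -[xa yb]; rewrite /p -xa -yb.
    by rewrite ltnNge (ltnW sxy).
  by apply: contraNneq xy => -[xb ya]; rewrite /p -xb -ya sxy.
- by rewrite /p; case: ifP => /= sab'; rewrite !permM ?tpermK ?tpermL ?tpermR; lia.
- exact: signz_sqr.
Qed.

(** * Unshuffles and their one-line words *)

Lemma unshuffleP m k (sigma : 'S_m) :
  reflect (forall i j : 'I_m, (i < j)%N -> (i < k)%N = (j < k)%N ->
             (sigma i < sigma j)%N)
          (unshuffle k sigma).
Proof.
apply: (iffP forallP) => [H i j ij e|H i].
  by have /forallP/(_ j)/implyP := H i; apply; lia.
by apply/forallP => j; apply/implyP => h; apply: H; lia.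
Qed.

Lemma sorted_enum_ord m : sorted (fun i j : 'I_m => (i < j)%N) (enum 'I_m).
Proof.
have := iota_ltn_sorted 0 m; rewrite -val_enum_ord sorted_map.
by [].
Qed.

Lemma sorted_consecutive m (r : seq 'I_m) (i j : 'I_m) :
  sorted (fun i j : 'I_m => (i < j)%N) r -> j = i.+1 :> nat ->
  i \in r -> j \in r -> exists u v, r = u ++ i :: j :: v.
Proof.
have tr : transitive (fun i j : 'I_m => (i < j)%N) by move=> ? ? ?; exact: ltn_trans.
rewrite (sorted_pairwise tr) => sr ij ir; case/splitPr: ir sr => u w.
rewrite pairwise_cat pairwise_cons => /and4P[/allrelP uw _ iw pw].
rewrite mem_cat inE => /or3P[ju|/eqP ji|jw].
- by have := uw j i ju (mem_head _ _); lia.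
- by move: ij; rewrite ji; lia.
case: w jw iw pw {uw} => //= y w jw /andP[iy _] /andP[/allP yw _].
exists u, w; move: jw; rewrite inE => /predU1P[->//|/yw]; lia.
Qed.

Definition one_line m (sigma : 'S_m) : seq 'I_m := map sigma (enum 'I_m).

Lemma one_line_uniq m (sigma : 'S_m) : uniq (one_line sigma).
Proof. by rewrite map_inj_uniq ?enum_uniq //; exact: perm_inj. Qed.

Lemma mem_one_line m (sigma : 'S_m) i : i \in one_line sigma.
Proof. by apply/mapP; exists (sigma^-1%g i); rewrite ?permKV ?mem_enum. Qed.

Lemma one_line1 m : one_line (1%g : 'S_m) = enum 'I_m.
Proof. by rewrite /one_line (eq_map (perm1 (T:=_))) map_id. Qed.

Lemma one_lineM m (sigma tau : 'S_m) : one_line (sigma * tau)%g = map tau (one_line sigma).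
Proof. by rewrite /one_line -map_comp; apply: eq_map => x; rewrite /= permM. Qed.

Lemma mem_take_enum m k (i : 'I_m) : (i \in take k (enum 'I_m)) = (i < k)%N.
Proof. by rewrite in_take ?mem_enum // index_enum_ord. Qed.

Lemma mem_drop_enum m k (i : 'I_m) : (i \in drop k (enum 'I_m)) = (k <= i)%N.
Proof.
have := enum_uniq 'I_m; rewrite -{1}(cat_take_drop k (enum 'I_m)) cat_uniq.
case/and3P => _ /hasPn h _.
have : i \in enum 'I_m by rewrite mem_enum.
rewrite -{1}(cat_take_drop k (enum 'I_m)) mem_cat mem_take_enum => ki.
apply/idP/idP => [/h|]; first by rewrite /= mem_take_enum -leqNgt.
by rewrite leqNgt => /negbTE ik; rewrite ik in ki.
Qed.

(** Each block of the one-line word is increasing, hence determined by its set of values, and the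
    values of the second block are the complement of those of the first. *)
Lemma unshuffle_eq m k (sigma rho : 'S_m) : unshuffle k sigma -> unshuffle k rho ->
  take k (one_line sigma) =i take k (one_line rho) -> sigma = rho.
Proof.
move=> us ur e.
have tr : transitive (fun i j : 'I_m => (i < j)%N) by move=> ? ? ?; exact: ltn_trans.
have ir : irreflexive (fun i j : 'I_m => (i < j)%N) by move=> ?; exact: ltnn.
have pe : pairwise (fun i j : 'I_m => (i < j)%N) (enum 'I_m).
  by rewrite -(sorted_pairwise tr) sorted_enum_ord.
have S (pi : 'S_m) (r : seq 'I_m) b : unshuffle k pi -> 
    pairwise (fun i j : 'I_m => (i < j)%N) r -> {in r, forall i : 'I_m, (i < k)%N = b} ->
    sorted (fun i j : 'I_m => (i < j)%N) (map pi r).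
  move=> /unshuffleP up pr rk; rewrite (sorted_pairwise tr) pairwise_map.
  apply: (sub_in_pairwise (P := [in r])); last exact: pr.
    by move=> x y xr yr xy; apply: up; rewrite // (rk x) // (rk y).
  by apply/allP.
have E : one_line sigma = one_line rho.
  rewrite -(cat_take_drop k (one_line sigma)) -(cat_take_drop k (one_line rho)).
  congr (_ ++ _); apply: (irr_sorted_eq tr ir) => //.
  - rewrite -map_take; apply: (S _ _ true) => [//||x]; last by rewrite mem_take_enum.
    exact: subseq_pairwise (take_subseq _ _) pe.
  - rewrite -map_take; apply: (S _ _ true) => [//||x]; last by rewrite mem_take_enum.
    exact: subseq_pairwise (take_subseq _ _) pe.
  - rewrite -map_drop; apply: (S _ _ false) => [//||x]; last by rewrite mem_drop_enum; lia.
    exact: subseq_pairwise (drop_subseq _ _) pe.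
  - rewrite -map_drop; apply: (S _ _ false) => [//||x]; last by rewrite mem_drop_enum; lia.
    exact: subseq_pairwise (drop_subseq _ _) pe.
  have D (pi : 'S_m) x : (x \in drop k (one_line pi)) = (x \notin take k (one_line pi)).
    rewrite -map_drop -map_take -{1 2}(permKV pi x) !(mem_map perm_inj).
    by rewrite mem_drop_enum mem_take_enum leqNgt.
  by move=> x; rewrite !D e.
apply/permP => x; have /eq_in_map := E; apply; exact: mem_enum.
Qed.

(** The values [i] and [j] lie in different blocks, so their order is never tested, and exchanging
    them changes no other comparison. *)
Lemma unshuffle_tpermr m k (sigma : 'S_m) (i j : 'I_m) : j = i.+1 :> nat ->
  ((sigma^-1 i)%g < k)%N != ((sigma^-1 j)%g < k)%N ->
  unshuffle k sigma -> unshuffle k (sigma * tperm i j)%g.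
Proof.
move=> ij ne /unshuffleP us; apply/unshuffleP => x y xy e; rewrite !permM.
rewrite ltn_tperm ?us //; apply: contraNneq ne => -[xi yj].
  by rewrite -xi -yj !permK e.
by rewrite -xi -yj !permK e.
Qed.

(** [sigma] increases on the block, so a position strictly between the two would carry a value
    strictly between [i] and [i + 1]. *)
Lemma unshuffle_consecutive m k (sigma : 'S_m) (i j : 'I_m) : j = i.+1 :> nat ->
  ((sigma^-1 i)%g < k)%N = ((sigma^-1 j)%g < k)%N ->
  unshuffle k sigma -> (sigma^-1 j)%g = (sigma^-1 i)%g.+1 :> nat.
Proof.
set a := (sigma^-1 i)%g; set b := (sigma^-1 j)%g => ij e /unshuffleP us.
have ea : sigma a = i by rewrite permKV.
have eb : sigma b = j by rewrite permKV.
have ab : (a < b)%N.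
  rewrite ltn_neqAle leqNgt; apply/andP; split.
    by apply/eqP => /val_inj ab; move: ij; rewrite -ea -eb ab; lia.
  by apply/negP => /us; rewrite e ea eb => /(_ erefl); lia.
apply/eqP; rewrite eqn_leq ab andbT leqNgt; apply/negP => ab'.
pose c := Ordinal (ltn_trans ab' (ltn_ord b)).
have h1 : (sigma a < sigma c)%N by apply: us => //=; lia.
have h2 : (sigma c < sigma b)%N by apply: us => //=; lia.
by move: h1 h2; rewrite ea eb; lia.
Qed.

(** The value [i] comes first and the others keep their order. These permutations index the terms of
    [insertion (euler V) L]. *)
Lemma unshuffle_lift_perm m (i : 'I_m.+1) : unshuffle 1 (lift_perm ord0 i 1).
Proof.
apply/unshuffleP => x y xy e.
case: (unliftP ord0 x) xy e => [x'|] ->; case: (unliftP ord0 y) => [y'|] -> //=.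
by rewrite !lift_perm_lift !perm1 /= /bump; lia.
Qed.

Lemma unshuffle1P m (sigma : 'S_m.+1) :
  unshuffle 1 sigma -> sigma = lift_perm ord0 (sigma ord0) 1.
Proof.
move=> us; apply: (unshuffle_eq us (unshuffle_lift_perm _)).
by rewrite /one_line enum_ordSl /= !take0 lift_perm_id.
Qed.

Lemma unshuffle_full m (sigma : 'S_m) : unshuffle m sigma = (sigma == 1%g).
Proof.
apply/idP/eqP => [us|->]; last by apply/unshuffleP => i j ij _; rewrite !perm1.
apply: (@unshuffle_eq _ m) => //; first by apply/unshuffleP => i j ij _; rewrite !perm1.
have st (pi : 'S_m) : take m (one_line pi) = one_line pi.
  by rewrite take_oversize // size_map size_enum_ord.
by move=> x; rewrite !st !mem_one_line.
Qed.

Lemma lift_perm_tperm m (i j : 'I_m.+1) : j = i.+1 :> nat ->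
  lift_perm ord0 j 1 = (lift_perm ord0 i 1 * tperm i j)%g.
Proof.
move=> ij; apply/permP => x; rewrite permM.
case: (unliftP ord0 x) => [x'|] ->; last by rewrite !lift_perm_id tpermL.
rewrite !lift_perm_lift !perm1; apply: val_inj.
case: tpermP => [/(congr1 val)|/(congr1 val)|/eqP + /eqP +]; rewrite -?val_eqE /= /bump; lia.
Qed.

End Permutations.

(** * Insertion of vector valued forms *)

Section VectorValuedForms.
Context (R : realType) (V : gradedSpace R).
Implicit Types (K L : vvform V) (s t : seq V) (x y : V) (p q : gindex V).

Definition vvlinear K := forall s t (c : R) x y,
  K (s ++ (c *: x + y) :: t) = c *: K (s ++ x :: t) + K (s ++ y :: t).

Definition vvsymmetric K := forall s t (e e' : int) x y,
  of_degree e x -> of_degree e' y ->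
  K (s ++ x :: y :: t) = (-1) ^ (e * e') *: K (s ++ y :: x :: t).

Definition vvdegree (delta : int) K := forall s (e : 'I_(size s) -> int),
  (forall i, of_degree (e i) (tnth (in_tuple s) i)) ->
  of_degree (\sum_i e i + delta) (K s).

Lemma gproj0 p : gproj p (0 : V) = 0.
Proof. by have := gproj_linear p (-1) 0 0; rewrite scaler0 addr0 scaleN1r addNr. Qed.

Lemma of_degree0 e : of_degree e (0 : V).
Proof. by move=> p _; rewrite gproj0. Qed.

Lemma of_degreeP e c x y : of_degree e x -> of_degree e y -> of_degree e (c *: x + y).
Proof. by move=> ex ey p pe; rewrite gproj_linear ex // ey // scaler0 addr0. Qed.

Lemma of_degreeZ e c x : of_degree e x -> of_degree e (c *: x).
Proof. by move=> ex; rewrite -[_ *: _]addr0; exact: of_degreeP ex (@of_degree0 e). Qed.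

Lemma of_degree_sum e (I : Type) (r : seq I) (P : pred I) (F : I -> V) :
  (forall i, P i -> of_degree e (F i)) -> of_degree e (\sum_(i <- r | P i) F i).
Proof.
move=> eF; elim/big_rec: _ => [|i x Pi ex]; first exact: of_degree0.
by rewrite -[F i]scale1r; exact: of_degreeP (eF i Pi) ex.
Qed.

Lemma of_degree_gproj p x : of_degree (gdeg p) (gproj p x).
Proof. by move=> q; rewrite gprojK; have [->|//] := eqVneq q p; rewrite eqxx. Qed.

Lemma vvlinear0 K s t : vvlinear K -> K (s ++ 0 :: t) = 0.
Proof.
by move=> lK; have := lK s t (-1) 0 0; rewrite scaler0 addr0 scaleN1r addNr.
Qed.

Lemma vvlinearD K s t x y : vvlinear K ->
  K (s ++ (x + y) :: t) = K (s ++ x :: t) + K (s ++ y :: t).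
Proof. by move=> lK; rewrite -{1}[x]scale1r lK scale1r. Qed.

Lemma vvlinearZ K s t c x : vvlinear K -> K (s ++ (c *: x) :: t) = c *: K (s ++ x :: t).
Proof. by move=> lK; rewrite -[c *: x]addr0 lK vvlinear0 // addr0. Qed.

Lemma vvlinear_sum K s t (I : Type) (r : seq I) (P : pred I) (F : I -> V) :
  vvlinear K -> K (s ++ (\sum_(i <- r | P i) F i) :: t) =
                \sum_(i <- r | P i) K (s ++ F i :: t).
Proof.
move=> lK; elim/big_rec2: _ => [|i x y _ <-]; first exact: vvlinear0.
exact: vvlinearD.
Qed.

Lemma vvlinear_ext K L : vvlinear K -> vvlinear L ->
  (forall s, {in s, forall x, exists p, gproj p x = x} -> K s = L s) -> K = L.
Proof.
move=> lK lL KL; apply/funext => t.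
(* The prefix [u] collects the arguments already replaced by homogeneous components. *)
suff H u : {in u, forall x, exists p, gproj p x = x} -> K (u ++ t) = L (u ++ t).
  exact: (H [::]).
elim: t u => [|x t IH] u hu; first by rewrite cats0; exact: KL.
rewrite -[x]gproj_sum !vvlinear_sum //; apply: eq_bigr => p _.
rewrite -!cat_rcons; apply: IH => y; rewrite mem_rcons inE => /predU1P[->|/hu//].
by exists p; rewrite gprojK eqxx.
Qed.

Lemma eq_map_notin (I : eqType) (T : Type) (i : I) (X Y Z : I -> T) :
  (forall j, j != i -> X j = Y j /\ X j = Z j) ->
  forall r, i \notin r -> map X r = map Y r /\ map X r = map Z r.
Proof.
move=> Xj r ir; split; apply/eq_in_map => j jr;
  by case: (Xj j) => //; apply: contraNneq ir => <-.
Qed.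

Lemma vvlinear_map K (I : eqType) (r : seq I) (i : I) c (X Y Z : I -> V) :
  vvlinear K -> uniq r -> i \in r -> X i = c *: Y i + Z i ->
  (forall j, j != i -> X j = Y j /\ X j = Z j) ->
  K (map X r) = c *: K (map Y r) + K (map Z r).
Proof.
move=> lK ur ir Xi Xj; case/splitPr: ir ur => u v.
rewrite cat_uniq /= => /and4P[_ /norP[iu _] iv _].
have E := eq_map_notin Xj.
have [uY uZ] := E _ iu; have [vY vZ] := E _ iv.
by rewrite !map_cat /= Xi lK {1}uY {1}vY uZ vZ.
Qed.

Definition plug K L k t : V := L (K (take k t) :: drop k t).

Lemma plug_linear K L k (I : eqType) (r : seq I) (i : I) c (X Y Z : I -> V) :
  vvlinear K -> vvlinear L -> uniq r -> i \in r -> X i = c *: Y i + Z i ->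
  (forall j, j != i -> X j = Y j /\ X j = Z j) ->
  plug K L k (map X r) = c *: plug K L k (map Y r) + plug K L k (map Z r).
Proof.
move=> lK lL ur ir Xi Xj; rewrite /plug -!map_take -!map_drop.
have E := eq_map_notin Xj.
move: ur ir; rewrite -{1 2}(cat_take_drop k r) cat_uniq mem_cat.
set u := take k r; set v := drop k r => /and3P[uu /hasPn uv vv].
have [iu _|niu /= iv] := boolP (i \in u).
  have iv : i \notin v by apply/negP => /uv; rewrite /= iu.
  rewrite (vvlinear_map lK uu iu Xi Xj) (lL [::]) /=.
  by have [<- <-] := E _ iv.
have [<- <-] := E _ niu.
have l' : vvlinear (fun s => L (K (map X u) :: s)).
  by move=> a b f x y; exact: (lL (_ :: a)).
exact: (vvlinear_map l' vv iv Xi Xj).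
Qed.

(** The part of [insertion] for one choice of homogeneous components. The degrees are a datum
    separate from the arguments, so that a permutation of the arguments is a composition applied to
    both [d] and [X]. *)
Definition insertion_at K L m (d : 'I_m -> int) (X : 'I_m -> V) : V :=
  \sum_(k < m.+1) \sum_(sigma : 'S_m | unshuffle k sigma)
    koszul_sign R d sigma *: plug K L k (map X (one_line sigma)).

Lemma map_one_line (T : Type) m (X : 'I_m -> T) (sigma : 'S_m) :
  map X (one_line sigma) = map (X \o sigma) (enum 'I_m).
Proof. by rewrite (map_comp X). Qed.

Lemma insertionE K L m s : size s = m ->
  insertion K L s = \sum_(e : {ffun 'I_m -> gindex V})
    insertion_at K L (fun i => gdeg (e i)) (fun i => gproj (e i) s`_i).
Proof.
move=> <-; apply: eq_bigr => e _; apply: eq_bigr => k _; apply: eq_bigr => sigma _.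
rewrite /= /plug map_one_line; set t := map _ _; set t' := map _ _.
have -> // : t = t'.
by apply: eq_map => i /=; rewrite (tnth_nth 0).
Qed.

Lemma insertion_at_linear K L m (d : 'I_m -> int) (i : 'I_m) c (X Y Z : 'I_m -> V) :
  vvlinear K -> vvlinear L -> X i = c *: Y i + Z i ->
  (forall j, j != i -> X j = Y j /\ X j = Z j) ->
  insertion_at K L d X = c *: insertion_at K L d Y + insertion_at K L d Z.
Proof.
move=> lK lL Xi Xj; rewrite /insertion_at scaler_sumr -big_split.
apply: eq_bigr => k _; rewrite scaler_sumr -big_split; apply: eq_bigr => sigma _ /=.
rewrite (@plug_linear K L k _ (one_line sigma) i c X Y Z) //.
- by rewrite scalerDr !scalerA mulrC.
- exact: one_line_uniq.
- exact: mem_one_line.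
Qed.

Lemma insertion_at_eq0 K L m (d : 'I_m -> int) (i : 'I_m) (X : 'I_m -> V) :
  vvlinear K -> vvlinear L -> X i = 0 -> insertion_at K L d X = 0.
Proof.
move=> lK lL Xi; have := @insertion_at_linear K L m d i (-1) X X X lK lL.
rewrite Xi scaler0 addr0 => -> //; by rewrite scaleN1r addNr.
Qed.

Lemma nth_mid s t x : (s ++ x :: t)`_(size s) = x.
Proof. by rewrite nth_cat ltnn subnn. Qed.

Lemma nth_off s t x y (j : nat) : j != size s -> (s ++ x :: t)`_j = (s ++ y :: t)`_j.
Proof.
by rewrite !nth_cat; case: ltngtP => // sj _; rewrite -(subnSK sj).
Qed.

Lemma insertion_linear K L : vvlinear K -> vvlinear L -> vvlinear (insertion K L).
Proof.
move=> lK lL s t c x y; pose m := (size s + (size t).+1)%N.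
have sm z : size (s ++ z :: t) = m by rewrite size_cat.
rewrite !(insertionE K L (sm _)) scaler_sumr -big_split; apply: eq_bigr => e _ /=.
have im : (size s < m)%N by rewrite /m; lia.
apply: (@insertion_at_linear _ _ _ _ (Ordinal im)) => //=.
  by rewrite !nth_mid gproj_linear.
by move=> j /=; rewrite -val_eqE /= => jm; split; congr (gproj _ _); exact: nth_off.
Qed.

(* Exchanging two adjacent arguments [i] and [j] turns the term of [sigma] in the
   insertion into the term of [sigma * tperm i j], which is an unshuffle unless
   [i] and [j] are in the same block; in that case the term itself is symmetric. *)
Definition merge_tperm m k (i j : 'I_m) (sigma : 'S_m) : 'S_m :=
  if ((sigma^-1 i)%g < k)%N == ((sigma^-1 j)%g < k)%N then sigma
  else (sigma * tperm i j)%g.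

Lemma merge_tpermK m k (i j : 'I_m) : involutive (merge_tperm k i j).
Proof.
move=> sigma; rewrite {2}/merge_tperm; case: ifP => e; first by rewrite /merge_tperm e.
rewrite /merge_tperm invMg tpermV !permM tpermL tpermR eq_sym e.
by rewrite -mulgA tperm2 mulg1.
Qed.

Lemma unshuffle_merge m k (i j : 'I_m) (sigma : 'S_m) : j = i.+1 :> nat ->
  unshuffle k (merge_tperm k i j sigma) = unshuffle k sigma.
Proof.
move=> ij.
have H tau : unshuffle k tau -> unshuffle k (merge_tperm k i j tau).
  by rewrite /merge_tperm; case: ifP => // /negbT; exact: unshuffle_tpermr.
by apply/idP/idP => [/H|/H//]; rewrite merge_tpermK.
Qed.

Lemma map_tperm_notin (T : Type) m (i j : 'I_m) (X : 'I_m -> T) (r : seq 'I_m) :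
  i \notin r -> j \notin r -> map (X \o tperm i j) r = map X r.
Proof.
move=> ir jr; apply/eq_in_map => l lr /=; rewrite tpermD //.
  by apply: contraNneq ir => ->.
by apply: contraNneq jr => ->.
Qed.

Lemma vvsymmetric_map K m (r : seq 'I_m) (i j : 'I_m) (d : 'I_m -> int) (X : 'I_m -> V) u v :
  vvsymmetric K -> (forall l, of_degree (d l) (X l)) ->
  uniq r -> r = u ++ i :: j :: v ->
  K (map (X \o tperm i j) r) = (-1) ^ (d i * d j) *: K (map X r).
Proof.
move=> sK dX + rE; rewrite rE cat_uniq /= => /and5P[_ /norP[iu /norP[ju _]] /norP[_ iv] jv _].
by rewrite !map_cat /= !map_tperm_notin // tpermL tpermR (sK _ _ _ _ _ _ (dX j) (dX i)) mulrC.
Qed.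

Lemma plug_symmetric K L k m (i j : 'I_m) (d : 'I_m -> int) (X : 'I_m -> V) :
  vvlinear L -> vvsymmetric K -> vvsymmetric L ->
  (forall l, of_degree (d l) (X l)) -> j = i.+1 :> nat -> (i < k)%N = (j < k)%N ->
  plug K L k (map (X \o tperm i j) (enum 'I_m)) =
  (-1) ^ (d i * d j) *: plug K L k (map X (enum 'I_m)).
Proof.
move=> lL sK sL dX ij ijk; rewrite /plug -2!map_take -2!map_drop.
have := enum_uniq 'I_m; rewrite -{1}(cat_take_drop k (enum 'I_m)) cat_uniq.
case/and3P => ut _ ud.
have [ik|ki] := ltnP i k.
  have [||u [v e]] := sorted_consecutive (take_sorted k (sorted_enum_ord m)) ij.
  - by rewrite mem_take_enum.
  - by rewrite mem_take_enum -ijk.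
  rewrite (vvsymmetric_map sK dX ut e) (vvlinearZ [::] _ _ _ lL) /=.
  by rewrite [map _ (drop _ _)]map_tperm_notin // mem_drop_enum; lia.
have [||u [v e]] := sorted_consecutive (drop_sorted k (sorted_enum_ord m)) ij.
- by rewrite mem_drop_enum.
- by rewrite mem_drop_enum; lia.
rewrite [map _ (take _ _)]map_tperm_notin ?mem_take_enum; try lia.
have s' : vvsymmetric (fun s => L (K (map X (take k (enum 'I_m))) :: s)).
  by move=> a b f x y z; exact: (sL (_ :: a)).
exact: (vvsymmetric_map s' dX ud e).
Qed.

Lemma insertion_at_symmetric K L m (i j : 'I_m) (d : 'I_m -> int) (X : 'I_m -> V) :
  vvlinear L -> vvsymmetric K -> vvsymmetric L ->
  (forall l, of_degree (d l) (X l)) -> j = i.+1 :> nat ->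
  insertion_at K L (d \o tperm i j) (X \o tperm i j) =
  (-1) ^ (d i * d j) *: insertion_at K L d X.
Proof.
move=> lL sK sL dX ij; rewrite /insertion_at scaler_sumr; apply: eq_bigr => k _.
rewrite scaler_sumr [RHS](reindex_inj (inv_inj (@merge_tpermK m k i j))) /=.
apply: eq_big => sigma; first by rewrite unshuffle_merge.
move=> us; rewrite koszul_sign_tpermr // /merge_tperm.
case: ifP => [/eqP e|_]; last first.
  by rewrite one_lineM (map_comp X) -scalerA.
set a := (sigma^-1 i)%g; set b := (sigma^-1 j)%g.
have ab : b = a.+1 :> nat := unshuffle_consecutive ij e us.
have ea : sigma a = i by rewrite permKV.
have eb : sigma b = j by rewrite permKV.
(* By conjugation, exchanging the values [i] and [j] is exchanging the consecutive positions [a] and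
   [b]. This gives one sign from [koszul_sign_tperml] and one from [plug_symmetric]. *)
have -> : (sigma * tperm i j = tperm a b * sigma)%g.
  by rewrite -ea -eb -tpermJ conjgE !mulgA mulgV mul1g.
rewrite koszul_sign_tperml // ea eb mulrA signz_sqr mul1r.
have -> : map (X \o tperm i j) (one_line sigma) =
    map ((X \o sigma) \o tperm a b) (enum 'I_m).
  rewrite map_one_line; apply: eq_map => l /=; rewrite -ea -eb; congr (X _).
  by rewrite (inj_tperm _ _ _ (@perm_inj _ sigma)).
rewrite (@plug_symmetric _ _ _ _ _ _ (d \o sigma)) //=.
by rewrite ea eb !scalerA mulrC map_one_line.
Qed.

Lemma insertion_symmetric K L : vvlinear K -> vvlinear L ->
  vvsymmetric K -> vvsymmetric L -> vvsymmetric (insertion K L).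
Proof.
move=> lK lL sK sL s t f f' x y fx fy; pose m := (size s + (size t).+2)%N.
have sm z w : size (s ++ z :: w :: t) = m by rewrite size_cat.
rewrite !(insertionE K L (sm _ _)) scaler_sumr.
have im : (size s < m)%N by rewrite /m; lia.
have jm : ((size s).+1 < m)%N by rewrite /m; lia.
pose i := Ordinal im; pose j := Ordinal jm.
(* The choice of components has to follow the arguments when these are exchanged. *)
pose phi (e : {ffun 'I_m -> gindex V}) := [ffun l => e (tperm i j l)].
have phiK : involutive phi by move=> e; apply/ffunP => l; rewrite !ffunE tpermK.
rewrite (reindex_inj (inv_inj phiK)); apply: eq_bigr => e _ /=.
set X := fun l : 'I_m => gproj (e l) (s ++ y :: x :: t)`_l.
have eX : (fun l : 'I_m => gproj (phi e l) (s ++ x :: y :: t)`_l) = X \o tperm i j.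
  apply/funext => l; rewrite /X /= ffunE; congr (gproj _ _).
  case: tpermP => [->|->|] /=.
  - by rewrite nth_mid -cat_rcons -(size_rcons s y) nth_mid.
  - by rewrite nth_mid -cat_rcons -(size_rcons s x) nth_mid.
  - move=> /eqP; rewrite -val_eqE /= => li /eqP; rewrite -val_eqE /= => lj.
    rewrite (nth_off _ x y) // -(cat_rcons y s (y :: t)) -(cat_rcons y s (x :: t)).
    by rewrite (@nth_off (rcons s y) t y x) // size_rcons.
have eD : (fun l : 'I_m => gdeg (phi e l)) = (fun l => gdeg (e l)) \o tperm i j.
  by apply/funext => l; rewrite /= ffunE.
rewrite eX eD insertion_at_symmetric //; last by move=> l; exact: of_degree_gproj.
(* A choice [e] that does not match the degrees of [x] and [y] projects one of them to zero, and
   then both sides vanish. *)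
have [->|fi] := eqVneq (gdeg (e i)) f'; last first.
  have Xi : X i = 0 by rewrite /X /= nth_mid; apply: fy.
  by rewrite (insertion_at_eq0 _ lK lL Xi) !scaler0.
have [->|fj] := eqVneq (gdeg (e j)) f; first by rewrite mulrC.
have Xj : X j = 0 by rewrite /X /= -cat_rcons -(size_rcons s y) nth_mid; apply: fx.
by rewrite (insertion_at_eq0 _ lK lL Xj) !scaler0.
Qed.

Lemma vvdegree_map K delta (I : Type) (r : seq I) (d : I -> int) (X : I -> V) :
  vvdegree delta K -> (forall l, of_degree (d l) (X l)) ->
  of_degree (\sum_(l <- r) d l + delta) (K (map X r)).
Proof.
move=> dK dX; case: r => [|i0 r].
  have := dK [::] (fun=> 0); rewrite big_nil big_ord0; apply=> -[] //.
set r' := i0 :: r.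
have -> : \sum_(l <- r') d l = \sum_(i < size (map X r')) d (nth i0 r' i).
  by rewrite (big_nth i0) big_mkord size_map.
apply: dK => i; rewrite (tnth_nth 0) (nth_map i0); last by rewrite -(size_map X).
exact: dX.
Qed.

Lemma vvdegree_plug K L delta delta' k (I : Type) (r : seq I) (d : I -> int) (X : I -> V) :
  vvdegree delta K -> vvdegree delta' L -> (forall l, of_degree (d l) (X l)) ->
  of_degree (\sum_(l <- r) d l + (delta + delta')) (plug K L k (map X r)).
Proof.
move=> dK dL dX; rewrite /plug -map_take -map_drop.
(* The index [None] stands for the first argument of [L], the value of [K]. *)
pose d' o := if o is Some l then d l else \sum_(l <- take k r) d l + delta.
pose X' o := if o is Some l then X l else K (map X (take k r)).
have := @vvdegree_map L delta' _ (None :: map Some (drop k r)) d' X' dL.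
rewrite big_cons /= big_map -map_comp /=.
have -> : \sum_(l <- r) d l = \sum_(l <- take k r) d l + \sum_(l <- drop k r) d l.
  by rewrite -big_cat cat_take_drop.
rewrite (addrAC _ delta) -(addrA _ delta).
by apply; case=> [l|] //=; exact: vvdegree_map.
Qed.

Lemma insertion_degree K L delta delta' : vvlinear K -> vvlinear L ->
  vvdegree delta K -> vvdegree delta' L -> vvdegree (delta + delta') (insertion K L).
Proof.
move=> lK lL dK dL s e es; rewrite (insertionE K L (erefl (size s))).
apply: of_degree_sum => f _.
have [fe|] := boolP [forall i, gdeg (f i) == e i]; last first.
  rewrite negb_forall => /existsP[i fi].
  rewrite (@insertion_at_eq0 _ _ _ _ i) //; first exact: of_degree0.
  by have := es i; rewrite (tnth_nth 0) => /(_ _ fi).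
apply: of_degree_sum => k _; apply: of_degree_sum => sigma _; apply: of_degreeZ.
have -> : \sum_i e i = \sum_(i <- one_line sigma) gdeg (f i).
  rewrite /one_line big_map big_enum [LHS](reindex_inj (@perm_inj _ sigma)) /=.
  by apply: eq_bigr => i _; have /forallP/(_ (sigma i))/eqP := fe.
by apply: vvdegree_plug => // l; exact: of_degree_gproj.
Qed.

Lemma insertion_vvform K L delta delta' : is_vvform delta K -> is_vvform delta' L ->
  is_vvform (delta + delta') (insertion K L).
Proof.
move=> [lK sK dK] [lL sL dL]; split.
- exact: insertion_linear.
- exact: insertion_symmetric.
- exact: insertion_degree.
Qed.

End VectorValuedForms.

(** * The Euler map *)

Section Euler.
Context (R : realType) (V : gradedSpace R).
Implicit Types (K L : vvform V) (s t : seq V) (x y : V) (p q : gindex V).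

Lemma is_vvformP delta c K L :
  is_vvform delta K -> is_vvform delta L -> is_vvform delta (c *: K + L).
Proof.
move=> [lK sK dK] [lL sL dL]; split.
- move=> s t f x y; rewrite -[LHS]/(c *: K _ + L _) lK lL.
  rewrite -[RHS]/(f *: (c *: K _ + L _) + (c *: K _ + L _)).
  by rewrite !scalerDr addrACA !scalerA mulrC.
- move=> s t e f x y ex fy; rewrite -[LHS]/(c *: K _ + L _) (sK _ _ e f) // (sL _ _ e f) //.
  by rewrite -[RHS]/(_ *: (c *: K _ + L _)) scalerDr !scalerA mulrC.
- by move=> s e es; apply: of_degreeP; [exact: dK | exact: dL].
Qed.

Lemma is_vvformD delta K L :
  is_vvform delta K -> is_vvform delta L -> is_vvform delta (K + L).
Proof. by move=> vK vL; rewrite -[K]scale1r; exact: is_vvformP. Qed.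

Lemma is_vvformB delta K L :
  is_vvform delta K -> is_vvform delta L -> is_vvform delta (K - L).
Proof. by move=> vK vL; rewrite -scaleN1r addrC; exact: is_vvformP. Qed.

Lemma insertionDl K K' L : vvlinear L -> insertion (K + K') L = insertion K L + insertion K' L.
Proof.
move=> lL; apply/funext => s; rewrite -[RHS]/(insertion K L s + insertion K' L s).
rewrite /insertion -big_split; apply: eq_bigr => e _ /=.
rewrite -big_split; apply: eq_bigr => k _ /=; rewrite -big_split.
by apply: eq_bigr => sigma _ /=; rewrite (vvlinearD [::] _ _ _ lL) scalerDr.
Qed.

Lemma insertionDr K L L' : insertion K (L + L') = insertion K L + insertion K L'.
Proof.
apply/funext => s; rewrite -[RHS]/(insertion K L s + insertion K L' s).
rewrite /insertion -big_split; apply: eq_bigr => e _ /=.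
rewrite -big_split; apply: eq_bigr => k _ /=; rewrite -big_split.
by apply: eq_bigr => sigma _ /=; rewrite -scalerDr.
Qed.

(** Distinct projections compose to zero, so homogeneous arguments leave a single choice of
    components. *)
Lemma insertion_homogeneous K L m s (p : 'I_m -> gindex V) :
  vvlinear K -> vvlinear L -> size s = m ->
  (forall i : 'I_m, gproj (p i) s`_i = s`_i) ->
  insertion K L s = insertion_at K L (fun i => gdeg (p i)) (fun i => s`_i).
Proof.
move=> lK lL sm ps; rewrite (insertionE K L sm) (bigD1 (finfun p)) //= big1 ?addr0.
  rewrite (_ : (fun i => gdeg _) = fun i => gdeg (p i)); last by apply/funext => i; rewrite ffunE.
  by congr insertion_at; apply/funext => i; rewrite ffunE ps.
move=> e ne; have [i ei] : exists i, e i != p i.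
  apply/existsP; rewrite -negb_forall; apply: contraNN ne => /forallP h.
  by apply/eqP/ffunP => i; rewrite ffunE; apply/eqP.
by apply: (@insertion_at_eq0 _ _ _ _ _ _ i) => //; rewrite -ps gprojK (negPf ei).
Qed.

Lemma vvsymmetric_tperm K m (i j : 'I_m) (d : 'I_m -> int) (X : 'I_m -> V) :
  vvsymmetric K -> (forall l, of_degree (d l) (X l)) -> j = i.+1 :> nat ->
  K (map (X \o tperm i j) (enum 'I_m)) = (-1) ^ (d i * d j) *: K (map X (enum 'I_m)).
Proof.
move=> sK dX ij.
have [||u [v e]] := sorted_consecutive (sorted_enum_ord m) ij; rewrite ?mem_enum //.
exact: (vvsymmetric_map sK dX (enum_uniq _) e).
Qed.

(** By induction on [i], for all [d] and [X]: the exchange of two consecutive indices is absorbed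
    into [d] and [X], and its sign occurs twice, once in the Koszul sign and once from the symmetry
    of [L]. *)
Lemma vvsymmetric_lift_perm L m (d : 'I_m.+1 -> int) (X : 'I_m.+1 -> V) (i : 'I_m.+1) :
  vvsymmetric L -> (forall l, of_degree (d l) (X l)) ->
  koszul_sign R d (lift_perm ord0 i 1) *: L (map X (one_line (lift_perm ord0 i 1))) =
  L (map X (enum 'I_m.+1)).
Proof.
move=> sL; move: i => [n nm]; elim: n nm d X => [|n IH] nm d X dX.
  rewrite (_ : Ordinal nm = ord0); last exact: val_inj.
  by rewrite lift_perm1 koszul_sign1 one_line1 scale1r.
have nm' := ltnW nm; pose i := Ordinal nm'; set j := Ordinal nm.
have ij : j = i.+1 :> nat by [].
rewrite (lift_perm_tperm ij) one_lineM -(map_comp X).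
rewrite -[koszul_sign _ _ _]mul1r -(signz_sqr R (d i * d j)) -mulrA -koszul_sign_tpermr //.
have dX' l : of_degree ((d \o tperm i j) l) ((X \o tperm i j) l) by exact: dX.
by rewrite -scalerA (IH nm' _ _ dX') (vvsymmetric_tperm sL dX ij) scalerA signz_sqr scale1r.
Qed.

Lemma euler_homogeneous e x : of_degree e x -> euler V [:: x] = - e%:~R *: x.
Proof.
move=> ex; rewrite -[in RHS](gproj_sum x) scaler_sumr; apply: eq_bigr => p _.
by have [->//|/ex ->] := eqVneq (gdeg p) e; rewrite !scaler0.
Qed.

Lemma euler_eq0 s : size s != 1 -> euler V s = 0.
Proof. by case: s => [|x []]. Qed.

Lemma euler_vvform : is_vvform 0 (euler V).
Proof.
split.
- case=> [|z s] t c x y; last first.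
    by rewrite !euler_eq0 ?scaler0 ?addr0 // size_cat /= addnS.
  case: t => [|z t] /=; last by rewrite scaler0 addr0.
  rewrite scaler_sumr -big_split; apply: eq_bigr => p _ /=.
  by rewrite gproj_linear scalerDr !scalerA mulrC.
- move=> s t e e' x y _ _.
  by rewrite !euler_eq0 ?scaler0 // size_cat /= !addnS.
- move=> s e es; rewrite addr0.
  have [s1|s1] := eqVneq (size s) 1; last by rewrite euler_eq0 //; exact: of_degree0.
  case: s s1 e es => [|x []] // _ e es; rewrite big_ord1.
  have xe : of_degree (e ord0) x := es ord0.
  by rewrite (euler_homogeneous xe); exact: of_degreeZ.
Qed.

Lemma map_nth_enum m s : size s = m -> [seq s`_i | i : 'I_m <- enum 'I_m] = s.
Proof.
move=> sm; rewrite (map_comp (fun i => s`_i) val) val_enum_ord -[RHS](mkseq_nth 0).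
by rewrite /mkseq sm.
Qed.

(** [S] takes one argument, so only blocks of size 1 contribute. Moving the argument [i] back from
    the front cancels the Koszul sign and leaves minus its degree times [L s]. *)
Lemma insertion_euler L m s (p : 'I_m -> gindex V) :
  vvlinear L -> vvsymmetric L -> size s = m ->
  (forall i : 'I_m, gproj (p i) s`_i = s`_i) ->
  insertion (euler V) L s = - (\sum_i gdeg (p i))%:~R *: L s.
Proof.
move=> lL sL sm ps; have [lS _ _] := euler_vvform.
rewrite (insertion_homogeneous lS lL sm ps) -{2}(map_nth_enum sm).
set d := fun i => gdeg (p i); set X := fun i : 'I_m => s`_i.
have dX i : of_degree (d i) (X i) by rewrite /X -ps; exact: of_degree_gproj.
have -> : \sum_i gdeg (p i) = \sum_i d i by [].
have L0 k t : size (take k t) != 1 -> plug (euler V) L k t = 0.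
  by move=> t1; rewrite /plug euler_eq0 //; exact: (vvlinear0 [::] _ lL).
(* Without arguments there is no block of size 1, and both sides vanish. *)
move: d X dX => d X {p ps sm}; case: m d X => [|m] d X dX.
  rewrite big_ord0 oppr0 scale0r; apply: big1 => k _; apply: big1 => sigma _.
  have t0 : size (map X (one_line sigma)) = 0 by rewrite 2!size_map size_enum_ord.
  by rewrite L0 ?scaler0 // size_take_min t0 minn0.
(* [lift ord0 ord0] is the block size 1. *)
rewrite /insertion_at (bigD1 (lift ord0 ord0 : 'I_m.+2)) //= [X in _ + X]big1 ?addr0.
  rewrite (reindex_onto (fun i => lift_perm ord0 i 1) (fun sigma : 'S_m.+1 => sigma ord0)) /=.
    rewrite rmorph_sum -sumrN scaler_suml; apply: eq_big => i.
      by rewrite unshuffle_lift_perm lift_perm_id eqxx.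
    move=> _; rewrite -(vvsymmetric_lift_perm i sL dX) scalerA mulrC -scalerA.
    have [r ->] : exists r, one_line (lift_perm ord0 i 1) = i :: r.
      exists (behead (one_line (lift_perm ord0 i 1))).
      by rewrite /one_line enum_ordSl /= lift_perm_id.
    congr (_ *: _); rewrite /plug map_cons.
    have -> : take (lift ord0 ord0 : 'I_m.+2) (X i :: map X r) = [:: X i] by rewrite /= take0.
    have -> : drop (lift ord0 ord0 : 'I_m.+2) (X i :: map X r) = map X r by rewrite /= drop0.
    by rewrite (euler_homogeneous (dX i)) (vvlinearZ [::] _ _ _ lL).
  by move=> sigma /unshuffle1P.
move=> k k1; apply: big1 => sigma _; rewrite L0 ?scaler0 //.
rewrite size_take_min 2!size_map size_enum_ord.
have : k != 1 :> nat by apply: contraNneq k1 => e; apply/eqP/val_inj.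
by have := ltn_ord k; lia.
Qed.

(** [S] takes the value of [K] as its only argument, so [K] receives everything: only [k = m] and
    the identity remain. The coefficient is minus the degree of [K s]. *)
Lemma insertion_in_euler K delta m s (p : 'I_m -> gindex V) :
  is_vvform delta K -> size s = m ->
  (forall i : 'I_m, gproj (p i) s`_i = s`_i) ->
  insertion K (euler V) s = - (\sum_i gdeg (p i) + delta)%:~R *: K s.
Proof.
move=> [lK _ dK] sm ps; have [lS _ _] := euler_vvform.
rewrite (insertion_homogeneous lK lS sm ps) /insertion_at.
rewrite (bigD1 ord_max) //= [X in _ + X]big1 ?addr0.
  rewrite (big_pred1 1%g); last by move=> sigma; rewrite unshuffle_full.
  rewrite koszul_sign1 scale1r one_line1 (map_nth_enum sm) /plug take_oversize ?sm //.
  rewrite drop_oversize ?sm //; apply: euler_homogeneous.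
  rewrite -[X in K X](map_nth_enum sm) -big_enum /=; apply: vvdegree_map => // i.
  by rewrite -ps; exact: of_degree_gproj.
move=> k km; rewrite big1 // => sigma _; rewrite /plug euler_eq0 ?scaler0 //=.
rewrite size_drop 2!size_map size_enum_ord.
have : k != m :> nat by apply: contraNneq km => e; apply/eqP/val_inj.
by have := ltn_ord k; lia.
Qed.

(* The bracket when one of the two degrees is 0, in which case its sign is 1. *)
Definition vvbracket K L := insertion K L - insertion L K.

Lemma vvbracket_vvform K L delta delta' : is_vvform delta K -> is_vvform delta' L ->
  is_vvform (delta + delta') (vvbracket K L).
Proof.
move=> vK vL; apply: is_vvformB; first exact: insertion_vvform.
by rewrite addrC; exact: insertion_vvform.
Qed.

Lemma vvbracketDl K K' L : vvlinear L ->
  vvbracket (K + K') L = vvbracket K L + vvbracket K' L.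
Proof. by move=> lL; rewrite /vvbracket insertionDl // insertionDr opprD addrACA. Qed.

Lemma vvbracketDr K L L' : vvlinear K ->
  vvbracket K (L + L') = vvbracket K L + vvbracket K L'.
Proof. by move=> lK; rewrite /vvbracket insertionDl // insertionDr opprD addrACA. Qed.

Lemma vvbracketN K L : vvbracket K L = - vvbracket L K.
Proof. by rewrite /vvbracket opprB. Qed.

(** On homogeneous arguments the two insertions multiply [L s] by minus the sum of the degrees and
    by minus that sum plus [delta]; the difference is [delta]. *)
Lemma vvbracket_euler L delta : is_vvform delta L ->
  vvbracket (euler V) L = delta%:~R *: L.
Proof.
move=> vL; have vS := euler_vvform; have [lL sL dL] := vL.
have [lC _ _] := vvbracket_vvform vS vL.
apply: vvlinear_ext => // [s t c x y|s hs].
  rewrite -[LHS]/(_ *: L _) lL scalerDr -[RHS]/(c *: (_ *: L _) + _ *: L _).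
  by rewrite !scalerA mulrC.
have [|p ps] := @fin_all_exists _ _ (fun (i : 'I_(size s)) (p : gindex V) => gproj p s`_i = s`_i).
  by move=> i; apply: hs; exact: mem_nth.
rewrite -[LHS]/(insertion (euler V) L s - insertion L (euler V) s).
rewrite (insertion_euler lL sL _ ps) // (insertion_in_euler vL _ ps) //.
by rewrite -scalerBl opprK intrD addKr.
Qed.

Lemma RN_bracketE K L e : RN_bracket 0 e K L = vvbracket K L.
Proof. by rewrite /RN_bracket mul0r expr0z scale1r. Qed.

Lemma nijenhuis_euler_add (mu A : vvform V) : is_vvform 1 mu -> is_vvform 0 A ->
  vvbracket A (vvbracket A mu) = 0 -> nijenhuis mu (euler V + A).
Proof.
move=> vm vA AA; have vS := euler_vvform; have vN := is_vvformD vS vA.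
have vAA := is_vvformD vA vA; have vK := is_vvformD vS vAA.
(* With [A + A] in place of a multiple of [A], additivity of the bracket is enough. *)
split=> //; exists (euler V + (A + A)); rewrite !RN_bracketE.
have vB := vvbracket_vvform vA vm; rewrite add0r in vB.
have [lm _ _] := vm; have [lA _ _] := vA; have [lS _ _] := vS; have [lN _ _] := vN.
have [lB _ _] := vB; have [lAA _ _] := vAA; have [lK _ _] := vK.
have SA : vvbracket (euler V) A = 0 by rewrite (vvbracket_euler vA) scale0r.
split=> //.
  have Nm : vvbracket (euler V + A) mu = mu + vvbracket A mu.
    by rewrite vvbracketDl // (vvbracket_euler vm) scale1r.
  rewrite Nm vvbracketDr // Nm !vvbracketDl // AA addr0 (vvbracket_euler vB).
  by rewrite (vvbracket_euler vm) !scale1r -addrA.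
have CC L : vvbracket L L = 0 by rewrite /vvbracket subrr.
rewrite vvbracketDr // vvbracketDl // CC vvbracketN SA oppr0 addr0 add0r.
by rewrite vvbracketDl // !vvbracketDr // SA CC !addr0.
Qed.

End Euler.

(** * Vanishing of a double bracket by means of a subspace [Z] *)

Section Nilpotence.
Context (R : realType) (V : gradedSpace R) (Z : V -> Prop).
Hypothesis Z0 : Z 0.
Hypothesis ZP : forall (c : R) x y, Z x -> Z y -> Z (c *: x + y).
Hypothesis Zproj : forall p x, Z x -> Z (gproj p x).
Implicit Types (K L : vvform V) (s t : seq V) (x y z : V).

Lemma insertion_closed K L s : (forall u v, Z (L (K u :: v))) -> Z (insertion K L s).
Proof.
have ZD x y : Z x -> Z y -> Z (x + y) by rewrite -{2}[x]scale1r; exact: ZP.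
move=> KL; rewrite (insertionE K L (erefl (size s))).
apply: big_ind => // e _; apply: big_ind => // k _; apply: big_ind => // sigma _.
by rewrite -[_ *: _]addr0; exact: ZP (KL _ _) Z0.
Qed.

(** Whatever the unshuffle, [z] enters [plug] through one of its homogeneous components, which
    [Zproj] keeps in [Z]. *)
Lemma insertion_eq0 K L s t z : Z z ->
  (forall k u v w, Z w -> plug K L k (u ++ w :: v) = 0) ->
  insertion K L (s ++ z :: t) = 0.
Proof.
move=> Zz KL; pose m := (size s + (size t).+1)%N.
have sm : size (s ++ z :: t) = m by rewrite size_cat.
have im : (size s < m)%N by rewrite /m; lia.
pose i := Ordinal im.
rewrite (insertionE K L sm) big1 // => e _; apply: big1 => k _; apply: big1 => sigma _.
have := mem_one_line sigma i; case/splitPr => u v.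
rewrite map_cat /= KL ?scaler0 // nth_mid; exact: Zproj.
Qed.

Lemma vvbracket_nilpotent (mu A : vvform V) : vvlinear mu -> vvlinear A ->
  (forall s t z, Z z -> A (s ++ z :: t) = 0) -> (forall s, Z (A s)) ->
  (forall s t z, Z z -> (0 < size s + size t)%N -> mu (s ++ z :: t) = 0) ->
  (forall x, Z (mu [:: x])) ->
  vvbracket A (vvbracket A mu) = 0.
Proof.
move=> lm lA A0 ZA m0 Zm; have ZB s : Z (vvbracket A mu s).
  rewrite -[vvbracket A mu s]/(insertion A mu s - insertion mu A s).
  rewrite -scaleN1r addrC; apply: ZP; apply: insertion_closed => u v //.
  (* The first argument of [mu] is a value of [A], hence in [Z]: alone it falls under [Zm], followed
     by others under [m0]. *)
  by case: v => [//|x v]; rewrite (m0 [::]).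
have sub K L : insertion K L = 0 -> insertion L K = 0 -> vvbracket K L = 0.
  by rewrite /vvbracket => -> ->; rewrite subrr.
apply: sub; apply/funext => s.
  (* The first argument given to [[A, mu]] is a value of [A], so it is enough that both halves of
     [[A, mu]] vanish when an argument is in [Z]. *)
  rewrite /insertion big1 // => e _; apply: big1 => k _; apply: big1 => sigma _.
  set t := map _ _; rewrite -[vvbracket A mu _]/(insertion A mu _ - insertion mu A _) /=.
  have ZAt := ZA (take k t).
  rewrite (insertion_eq0 [::] _ ZAt) ?(insertion_eq0 [::] _ ZAt) ?subr0 ?scaler0 //.
    move=> l u v w Zw; rewrite /plug take_cat drop_cat; case: ltnP => lu.
      by rewrite -cat_cons A0.
    case: (l - size u)%N => [|l'] /=; first by rewrite (A0 [:: _]).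
    case: u {lu} => [|x u] /=; last by rewrite -cat_cons m0 // (vvlinear0 [::] _ lA).
    (* If [w] is the only argument of [mu], the value may be nonzero, but it lies in [Z], where [A]
       vanishes. *)
    case: (take l' v) => [|y v'] /=; first by rewrite (A0 [::]).
    by rewrite (m0 [::]) // (vvlinear0 [::] _ lA).
  move=> l u v w Zw; rewrite /plug take_cat drop_cat; case: ltnP => lu.
    by rewrite -cat_cons m0 //= addSn.
  case: (l - size u)%N => [|l'] /=; first by rewrite (m0 [:: _]).
  by rewrite A0 // (vvlinear0 [::] _ lm).
rewrite /insertion big1 // => e _; apply: big1 => k _; apply: big1 => sigma _.
by rewrite (A0 [::]) ?scaler0.
Qed.

End Nilpotence.

(** * Contractions by Hamiltonian vector fields *)

Section Contractions.
Context (R : realType) (M : manifold R) (n : nat) (omega : nplectic M n).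
Import numFieldNormedType.Exports.
Local Open Scope classical_set_scope.
Local Notation V := (vfields M).
Local Notation E := (E omega).
(* Unqualified, [contract] is the map on extended reals of the analysis library. *)
Local Notation contract := (@Defs.contract R M).
Implicit Types (a b x y z : E) (s t : seq E) (X Y : V).

Definition form a : Omega M := E_val (a : E_carrier omega).
Local Notation ham := (@ham_vfield R M n omega).

Lemma form_linear c a b : form (c *: a + b) = c *: form a + form b.
Proof. by []. Qed.

Lemma form_proj p a : form (gproj p a) = component p (form a).
Proof. by []. Qed.

Lemma form_inj : injective form.
Proof. exact: val_inj. Qed.

Lemma ham_vfieldP a : dOmega (component n.-1 (form a)) = - contract (ham a) omega.
Proof. exact: (svalP (cid (ham_vfield_exists a))). Qed.

(** Non-degeneracy at each point, applied to [X - Y], shows that this derivation kills every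
    function. *)
Lemma contract_omega_inj X Y : contract X omega = contract Y omega -> X = Y.
Proof.
move=> XY; apply/eqP; rewrite -subr_eq0; apply/eqP/vfield_eq => f.
apply/val_inj/funext => x; apply: (@npl_nondegenerate R M n omega x (X - Y)) => s.
have e : omega (X :: s) = omega (Y :: s) := congr1 (fun a : Omega M => a s) XY.
have := (preformP omega).1 [::] s (-1) Y X; rewrite scaleN1r addrC /= => ->.
by rewrite e mulN1r addNr.
Qed.

Lemma ham_vfield_uniq a X : dOmega (component n.-1 (form a)) = - contract X omega ->
  ham a = X.
Proof. by rewrite ham_vfieldP => /oppr_inj; exact: contract_omega_inj. Qed.

Lemma ham_vfield_linear c a b : ham (c *: a + b) = cfun M c *: ham a + ham b.
Proof.
apply: ham_vfield_uniq; rewrite form_linear component_linear dOmega_linear !ham_vfieldP.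
rewrite scalerN -opprD; congr (- _); apply: Omega_eq => s.
by rewrite formDZE /= /Defs.iota -const_mul ((preformP omega).1 [::]).
Qed.

Lemma ham_vfield_eq0 a : dOmega (component n.-1 (form a)) = 0 -> ham a = 0.
Proof. by move=> da; apply: ham_vfield_uniq; rewrite da Defs.contract0 oppr0. Qed.

Lemma ham_vfield0 : ham 0 = 0.
Proof.
apply: ham_vfield_eq0; rewrite (_ : component _ _ = 0) ?dOmega0 //.
by apply: Omega_eq => s; rewrite /= /component_fun if_same.
Qed.

Lemma ham_vfield_proj p a : ham a = 0 -> ham (gproj p a) = 0.
Proof.
move=> a0; apply: ham_vfield_eq0; rewrite form_proj component_component.
by case: eqP => _; rewrite ?dOmega0 // ham_vfieldP a0 Defs.contract0 oppr0.
Qed.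

Lemma of_degree_component e a (p : nat) : of_degree e a -> p%:Z - n%:Z != e ->
  component p (form a) = 0.
Proof.
move=> ea pe; have [pn|np] := ltnP p n.
  by have := congr1 form (ea (Ordinal pn) pe).
apply: Omega_eq => s; rewrite /= /component_fun; case: eqP => // sp.
have /asboolP[h _] := E_valP (a : E_carrier omega).
by rewrite -[LHS]/(form a s); apply: h; rewrite sp.
Qed.

(** As [n] is positive, the truncated [n.-1] is the true predecessor, so that E_{-1} consists of the
    forms of degree [n.-1]. *)
Lemma predn_degree : n.-1%:Z - n%:Z = -1.
Proof. by have := npl_gt0 omega; lia. Qed.

Lemma ham_vfield_degree e a : of_degree e a -> e != -1 -> ham a = 0.
Proof.
move=> ea e1; apply: ham_vfield_eq0; rewrite (of_degree_component ea) ?dOmega0 //.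
by rewrite predn_degree eq_sym.
Qed.

Definition ham_contractions (o : Omega M) s := contractions (map ham s) o.

Lemma ham_contractionsP (o : Omega M) s t c x y :
  ham_contractions o (s ++ (c *: x + y) :: t) =
  c *: ham_contractions o (s ++ x :: t) + ham_contractions o (s ++ y :: t).
Proof.
apply: Omega_eq => u; rewrite formDZE !contractionsE !map_cat !rev_cat /= !rev_cons.
rewrite !cat_rcons -!catA !cat_cons ham_vfield_linear.
by rewrite (preformP o).1 const_mul.
Qed.

Lemma ham_contractions_eq0 (o : Omega M) s t z : ham z = 0 ->
  ham_contractions o (s ++ z :: t) = 0.
Proof.
move=> z0; apply: Omega_eq => u; rewrite contractionsE map_cat rev_cat /= rev_cons z0.
by rewrite cat_rcons -catA cat_cons (mlin0 _ _ (preformP o).1).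
Qed.

Lemma ham_contractions_swap (o : Omega M) s t x y :
  ham_contractions o (s ++ x :: y :: t) = - ham_contractions o (s ++ y :: x :: t).
Proof.
apply: Omega_eq => u; rewrite -[RHS]/(- (ham_contractions o (s ++ y :: x :: t) u)).
rewrite !contractionsE !map_cat !rev_cat /= !rev_cons !cat_rcons -!catA !cat_cons.
exact: (swap_adj _ _ _ _ (preformP o)).
Qed.

(** Covers [l_ k] for [k >= 2], with [omega] and degree 1, and [eta_tilde], with an [n]-form and
    degree 0. A homogeneous argument contributes only in degree -1, where graded symmetry is
    skew-symmetry, that is, the alternation of [o]. Then [i] arguments have total degree [- i], and
    contracting by them leaves a form of degree [p - i]. *)
Lemma contraction_vvform p (o : dform M p) i (c : R) (F : vvform E) :
  (forall s, form (F s) = if size s == i then c *: ham_contractions o s else 0) ->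
  is_vvform (p%:Z - n%:Z) F.
Proof.
move=> FE; split.
- move=> s t f x y; apply: form_inj; rewrite form_linear !FE !size_cat /=.
  case: eqP => _; last by rewrite scaler0 addr0.
  by rewrite ham_contractionsP scalerDr !scalerA mulrC.
- move=> s t e e' x y ex ey; apply: form_inj.
  rewrite -[_ *: _]addr0 form_linear !FE !size_cat /= addr0.
  case: eqP => _; last by rewrite scaler0.
  have [e1|e1] := eqVneq e (-1); last first.
    have x0 := ham_vfield_degree ex e1.
    rewrite (ham_contractions_eq0 _ _ _ x0) -cat_rcons.
    by rewrite (ham_contractions_eq0 _ _ _ x0) !scaler0.
  have [e1'|e1'] := eqVneq e' (-1); last first.
    have y0 := ham_vfield_degree ey e1'.
    rewrite (ham_contractions_eq0 _ _ _ y0) -cat_rcons.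
    by rewrite (ham_contractions_eq0 _ _ _ y0) !scaler0.
  by rewrite ham_contractions_swap e1 e1' scalerN mulrNN mulr1 expr1z scaleN1r.
move=> s e es q qe; apply: form_inj; rewrite form_proj; apply: Omega_eq => t.
rewrite /= /component_fun; case: eqP => // tq.
rewrite -[LHS]/(form (F s) t) FE; case: eqP => // si.
(* An argument of degree other than -1 has Hamiltonian vector field zero, so the value is zero. *)
have [/forallP e1|] := boolP [forall j, e j == -1]; last first.
  rewrite negb_forall => /existsP[j ej].
  rewrite -(cat_take_drop j s) (drop_nth 0) //.
  have := es j; rewrite (tnth_nth 0) => /ham_vfield_degree/(_ ej) h.
  by rewrite (ham_contractions_eq0 _ _ _ h) scaler0.
rewrite -[LHS]/(c *: (ham_contractions o s t)).
rewrite (contractions0 (dform_homogeneous o)) ?scaler0 //.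
apply: contraNneq qe; rewrite size_map tq.
have -> : \sum_i e i = - (size s)%:Z.
  rewrite (eq_bigr (fun=> -1)); last by move=> j _; apply/eqP.
  by rewrite sumr_const card_ord mulNrn natz.
move=> <-; rewrite /gdeg /= /E_deg; lia.
Qed.

Lemma Omega_linear_sum (f : Omega M -> Omega M) (I : Type) (r : seq I) (P : pred I)
    (c : I -> R) (F : I -> Omega M) :
  (forall k o o', f (k *: o + o') = k *: f o + f o') ->
  f (\sum_(i <- r | P i) c i *: F i) = \sum_(i <- r | P i) c i *: f (F i).
Proof.
move=> lf; elim/big_rec2: _ => [|i o' o _ <-]; last exact: lf.
by have := lf (-1) 0 0; rewrite scaler0 addr0 scaleN1r addNr.
Qed.

Lemma form_l1 a : form (l1 a) =
  \sum_(p < n.-1) (-1) ^ (p%:Z - n%:Z) *: dOmega (component p (form a)).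
Proof. by []. Qed.

Lemma l1_linear (c : R) a b : l1 (c *: a + b) = c *: l1 a + l1 b.
Proof.
apply: form_inj; rewrite form_l1 [RHS]form_linear !form_l1 form_linear scaler_sumr -big_split.
apply: eq_bigr => p _ /=; rewrite component_linear dOmega_linear.
by rewrite scalerDr !scalerA mulrC.
Qed.

Lemma component_d_component q p a : component q (dOmega (component p (form a))) =
  if p.+1 == q then dOmega (component p (form a)) else 0.
Proof. exact/component_id/dOmega_homogeneous/component_homogeneous. Qed.

Lemma l1_degree e a : of_degree e a -> of_degree (e + 1) (l1 a).
Proof.
move=> ea q qe; apply: form_inj; rewrite form_proj form_l1.
rewrite Omega_linear_sum; last by move=> *; exact: component_linear.
apply: big1 => p _; rewrite component_d_component; case: eqP => pq; last exact: scaler0.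
rewrite (of_degree_component ea) ?dOmega0 ?scaler0 //.
by apply: contraNneq qe => <-; rewrite /gdeg /= /E_deg; lia.
Qed.

(** Every term of [l1 a] is exact and homogeneous, so the component of degree [n.-1] is exact, hence
    closed. *)
Lemma ham_vfield_l1 a : ham (l1 a) = 0.
Proof.
apply: ham_vfield_eq0; rewrite form_l1.
rewrite (@Omega_linear_sum (fun o => dOmega (component n.-1 o))); last first.
  by move=> *; rewrite component_linear dOmega_linear.
apply: big1 => p _; rewrite component_d_component.
by case: eqP => _; rewrite ?dOmegaK ?dOmega0 scaler0.
Qed.

Lemma l_1_vvform : is_vvform 1 (@l_ R M n omega 1).
Proof.
have l0 s : size s != 1 -> @l_ R M n omega 1 s = 0 by rewrite /l_ => /negbTE->.
split.
- case=> [|z s] t c x y; last first.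
    by rewrite !l0 ?scaler0 ?addr0 // size_cat /= addnS.
  case: t => [|z t]; first exact: l1_linear.
  by rewrite !l0 ?scaler0 ?addr0.
- by move=> s t e e' x y _ _; rewrite !l0 ?scaler0 // size_cat /= !addnS.
- move=> s e es.
  have [s1|s1] := eqVneq (size s) 1; last by rewrite l0 //; exact: of_degree0.
  case: s s1 e es => [|x []] // _ e es; rewrite big_ord1.
  exact: (l1_degree (es ord0)).
Qed.

Lemma l_vvform k : (0 < k)%N -> is_vvform 1 (@l_ R M n omega k).
Proof.
case: k => [//|[_|k _]]; first exact: l_1_vvform.
have <- : n.+1%:Z - n%:Z = 1 by lia.
apply: (@contraction_vvform _ omega k.+2 (l_sign R k.+2)) => s.
rewrite /l_; case: eqP => // sk.
by case: s sk => [|x [|y s]] //= sk; rewrite /form /= /lk_fun /= sk.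
Qed.

Lemma is_vvform0 delta : is_vvform delta (0 : vvform E).
Proof.
split=> [s t c x y|s t e e' x y _ _|s e _].
- by rewrite -[RHS]/(c *: 0 + 0) scaler0 addr0.
- by rewrite -[RHS]/(_ *: 0) scaler0.
- exact: of_degree0.
Qed.

Lemma is_vvform_sum delta i j (F : nat -> vvform E) :
  (forall k, (i <= k < j)%N -> is_vvform delta (F k)) ->
  is_vvform delta (\sum_(i <= k < j) F k).
Proof.
move=> vF; rewrite big_nat; apply: (big_ind (is_vvform delta)) => //.
- exact: is_vvform0.
- exact: is_vvformD.
Qed.

Lemma lie_n_algebra_vvform : is_vvform 1 (lie_n_algebra omega).
Proof. by apply: is_vvform_sum => k /andP[k0 _]; exact: l_vvform. Qed.

Lemma eta_tilde_vvform (eta : dform M n) i : (1 < i)%N ->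
  is_vvform 0 (eta_tilde omega eta i).
Proof.
move=> i1; have <- : n%:Z - n%:Z = 0 by lia.
apply: (@contraction_vvform _ eta i 1) => s.
rewrite /eta_tilde; case: eqP => // si; rewrite scale1r.
by rewrite /form /= /eta_fun si i1.
Qed.

Lemma eta_tilde_eq0 (eta : dform M n) i s t z : ham z = 0 ->
  eta_tilde omega eta i (s ++ z :: t) = 0.
Proof.
move=> z0; rewrite /eta_tilde; case: eqP => // _; apply: form_inj.
rewrite /form /= /eta_fun; case: ifP => // _.
exact: (ham_contractions_eq0 eta s t z0).
Qed.

(** An [n]-form contracted at least twice has degree at most [n - 2]. This puts the values of
    [eta_tilde] among the elements with zero Hamiltonian vector field. *)
Lemma eta_tilde_top (eta : dform M n) i s (Xs : seq V) : size Xs = n.-1 ->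
  form (eta_tilde omega eta i s) Xs = 0.
Proof.
move=> Xn; rewrite /eta_tilde; case: eqP => // _.
rewrite /form /= /eta_fun; case: ifP => // s1.
apply: (contractions0 (dform_homogeneous eta)); rewrite size_map Xn.
by have := npl_gt0 omega; lia.
Qed.

Lemma vvform_sumE i j (F : nat -> vvform E) s :
  (\sum_(i <= k < j) F k) s = \sum_(i <= k < j) F k s.
Proof. by elim/big_rec2: _ => // k f a _ <-. Qed.

(** The size condition asks for at least two arguments, which leaves out [l1]: it is a differential
    and need not vanish when the Hamiltonian vector field does. *)
Lemma lie_n_algebra_eq0 s t z : ham z = 0 -> (0 < size s + size t)%N ->
  lie_n_algebra omega (s ++ z :: t) = 0.
Proof.
move=> z0 st; rewrite /lie_n_algebra vvform_sumE big1 // => k _; rewrite /l_; case: eqP => // _.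
have st1 : (1 < size (s ++ z :: t))%N by rewrite size_cat /= addnS.
have -> : MkE (lk_subproof (s ++ z :: t)) = 0.
  apply: form_inj; rewrite /form /= /lk_fun st1.
  by rewrite [contractions _ _](ham_contractions_eq0 omega s t z0) scaler0.
by case: (s ++ z :: t) st1 => [|a []].
Qed.

Lemma ham_vfieldD a b : ham a = 0 -> ham b = 0 -> ham (a + b) = 0.
Proof. by move=> a0 b0; rewrite -[a]scale1r ham_vfield_linear a0 b0 scaler0 addr0. Qed.

Lemma ham_vfield_lie_n_algebra x : ham (lie_n_algebra omega [:: x]) = 0.
Proof.
rewrite /lie_n_algebra vvform_sumE; apply: (big_ind (fun a => ham a = 0)).
- exact: ham_vfield0.
- exact: ham_vfieldD.
- move=> k _; rewrite /l_; case: eqP => _; first exact: ham_vfield_l1.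
  exact: ham_vfield0.
Qed.

(** * Pointwise limits of vector valued forms *)

Section Series.
Variables (F : nat -> vvform E) (T : vvform E).
Hypothesis FT : vvseries F T.

(** One relation between three evaluations, with free lists and vector fields, is general enough to
    carry linearity, symmetry, degree and vanishing to the limit. *)
Lemma vvseries_linear (c : R) s s' s'' (Xs Xs' Xs'' : seq V) (m : M) :
  (forall j, form (F j s) Xs m = c * form (F j s') Xs' m + form (F j s'') Xs'' m :> R) ->
  form (T s) Xs m = c * form (T s') Xs' m + form (T s'') Xs'' m :> R.
Proof.
move=> Fs; have sumE (J : nat) t Ys : (((\sum_(1 <= j < J) F j) t : E_carrier omega) Ys m : R) =
    \sum_(1 <= j < J) (form (F j t) Ys m : R).
  rewrite vvform_sumE; elim/big_rec2: _ => // j r a _ <-.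
  by [].
have h t Ys : (fun J : nat => \sum_(1 <= j < J) (form (F j t) Ys m : R)) @ \oo
    --> (form (T t) Ys m : R).
  by have := @FT t Ys m; under eq_fun do rewrite sumE.
have e : (fun J : nat => \sum_(1 <= j < J) (form (F j s) Xs m : R)) =
    (fun J : nat => c * \sum_(1 <= j < J) (form (F j s') Xs' m : R) +
                    \sum_(1 <= j < J) (form (F j s'') Xs'' m : R)).
  apply/funext => J; rewrite mulr_sumr -big_split; apply: eq_bigr => j _; exact: Fs.
have hs := h s Xs; rewrite e in hs.
apply: (cvg_unique (@Rhausdorff R) hs); apply: cvgD; last exact: h.
by apply: cvgM; [exact: cvg_cst | exact: h].
Qed.

Lemma vvseries_eq0 s (Xs : seq V) (m : M) : (forall j, form (F j s) Xs m = 0 :> R) ->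
  form (T s) Xs m = 0 :> R.
Proof.
(* With three equal evaluations the relation reads [t = t + t]. *)
move=> F0; have := @vvseries_linear 1 s s s Xs Xs Xs m.
rewrite mul1r => /(_ _)/esym/eqP; rewrite -subr_eq0 addrK => h; apply/eqP/h => j.
by rewrite F0 mul1r addr0.
Qed.

Lemma vvseries_vvform delta : (forall j, is_vvform delta (F j)) -> is_vvform delta T.
Proof.
move=> vF; split.
- move=> s t c x y; apply: form_inj; apply: Omega_eq => Xs; apply/val_inj/funext => m.
  apply: vvseries_linear => j; have [lF _ _] := vF j.
  by rewrite lF.
- move=> s t e e' x y ex ey; apply: form_inj; apply: Omega_eq => Xs.
  apply/val_inj/funext => m.
  set r : R := (-1) ^ (e * e').
  (* The two-term relation is put into the three-term shape of [vvseries_linear]. *)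
  rewrite (_ : r *: _ = (r - 1) *: T (s ++ y :: x :: t) + T (s ++ y :: x :: t)); last first.
    by rewrite scalerBl scale1r subrK.
  apply: vvseries_linear => j; have [_ sF _] := vF j; rewrite (sF _ _ _ _ _ _ ex ey) -/r.
  by rewrite mulrBl mul1r subrK.
move=> s e es q qe; apply: form_inj; rewrite form_proj; apply: Omega_eq => Xs.
apply/val_inj/funext => m; rewrite /= /component_fun; case: eqP => // Xq.
apply: vvseries_eq0 => j; have [_ _ dF] := vF j.
have := congr1 (fun a => form a Xs m : R) (dF s e es q qe).
by rewrite form_proj /= /component_fun Xq eqxx.
Qed.

End Series.

(** Pointwise convergence gives no control on Hamiltonian vector fields, but the vanishing of the
    component of degree [n.-1] passes to the limit and forces the field to be zero. *)
Lemma ham_vfield_vvseries F T s : vvseries F T ->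
  (forall j s (Xs : seq V), size Xs = n.-1 -> form (F j s) Xs = 0) -> ham (T s) = 0.
Proof.
move=> FT F0; apply: ham_vfield_eq0; rewrite (_ : component _ _ = 0) ?dOmega0 //.
apply: Omega_eq => Xs; rewrite /= /component_fun; case: eqP => // Xn.
by apply/val_inj/funext => m; apply: (vvseries_eq0 FT) => j; rewrite F0.
Qed.

End Contractions.

Theorem theorem3p9 (R : realType) (M : manifold R) (n : nat)
    (omega : nplectic M n) (eta : nat -> dform M n) (T : vvform (E omega)) :
  vvseries (fun j => \sum_(2 <= i < n.+1) eta_tilde omega (eta j) i) T ->
  nijenhuis (lie_n_algebra omega) (euler (E omega) + T).
Proof.
move=> FT; have vm := lie_n_algebra_vvform omega.
have vT : is_vvform 0 T.
  apply: (vvseries_vvform FT) => j; apply: is_vvform_sum => i /andP[i1 _].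
  exact: eta_tilde_vvform.
apply: nijenhuis_euler_add => //; have [lm _ _] := vm; have [lT _ _] := vT.
apply: (@vvbracket_nilpotent _ _ (fun a => ham_vfield a = 0)) => //.
- exact: ham_vfield0.
- by move=> c x y x0 y0; rewrite ham_vfield_linear x0 y0 scaler0 addr0.
- by move=> p x; exact: ham_vfield_proj.
- move=> s t z z0; apply: form_inj; apply: Omega_eq => Xs; apply/val_inj/funext => m.
  apply: (vvseries_eq0 FT) => j; rewrite vvform_sumE big1 // => i _.
  exact: eta_tilde_eq0.
- move=> s; apply: (ham_vfield_vvseries _ FT) => j u Xs Xn.
  rewrite vvform_sumE [LHS]E_sumE big1 // => i _; exact: eta_tilde_top.
- by move=> s t z; exact: lie_n_algebra_eq0.
- by move=> x; exact: ham_vfield_lie_n_algebra.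
Qed.
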